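(* Let $X$ be a reflexive symmetric function space on $I$ such that the Cesàro operator $C$ is bounded on $X$. (i) If $I=[0,\infty)$, then the spaces $CX$ and $\widetilde{X'}$ do not have the Dunford–Pettis property. (ii) If $I=[0,1]$, $X$ has the Fatou property and the Copson operator $C^*$ is bounded on $X$, then the spaces $CX$ and $\widetilde{X'}$ do not have the Dunford–Pettis property.
   Context: A Banach ideal space on $I$ is a Banach space of measurable functions on $I$ with: $|f|\le|g|$ a.e., $g\in X$ imply $f\in X$, $\|f\|\le\|g\|$, and containing an a.e. positive function; it is symmetric if equimeasurable functions (same distribution function) have the same membership and norm. Köthe dual: $X'=\{g:\sup_{\|f\|_X\le1}\int_I|fg|<\infty\}$ with this supremum as norm. Fatou property: $0\le f_n\nearrow f$ a.e. and $\sup\|f_n\|<\infty$ imply $f\in X$ and $\|f_n\|\nearrow\|f\|$. $Cf(x)=\frac1x\int_0^xf(t)\,dt$, $C^*f(x)=\int_{I\cap[x,\infty)}\frac{f(t)}{t}\,dt$. $CX=\{f:C|f|\in X\}$, $\|f\|_{CX}=\|C|f|\|_X$; with $\widetilde f(x)=\operatorname{ess\,sup}_{t\in I,t\ge x}|f(t)|$, $\widetilde Y=\{f:\widetilde f\in Y\}$, $\|f\|_{\widetilde Y}=\|\widetilde f\|_Y$. Dunford–Pettis property: $x_n\to0$ weakly and $x_n^*\to0$ weakly in the dual imply $x_n^*(x_n)\to0$. *)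

(* Defs.v *)
From HB Require Import structures.
From mathcomp Require Import all_boot all_order all_algebra.
From mathcomp Require Import all_classical all_reals all_analysis.
Set Implicit Arguments. Unset Strict Implicit. Unset Printing Implicit Defensive.
Import Order.TTheory GRing.Theory Num.Theory.
Import numFieldNormedType.Exports.
Local Open Scope classical_set_scope.
Local Open Scope ring_scope.

Section Defs.
Variable R : realType.
Local Notation mu := (@lebesgue_measure R).
Local Notation fn := (R -> R).

Definition ae_in (I : set R) (P : R -> Prop) : Prop :=
  mu.-negligible (I `&` [set x | ~ P x]).

(* A (candidate) function space on I: membership predicate + norm. *)

Definition banach_ideal_space (I : set R) (mem : fn -> Prop) (nrm : fn -> R) : Prop :=
  (forall f : fn, mem f -> measurable_fun I f) /\
      mem (fun _ => 0) /\
      (forall f g, mem f -> mem g -> mem (fun x => f x + g x)) /\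
      (forall (a : R) f, mem f -> mem (fun x => a * f x)) /\
      (forall f g, mem f -> mem g -> nrm (fun x => f x + g x) <= nrm f + nrm g) /\
      (forall (a : R) f, mem f -> nrm (fun x => a * f x) = `|a| * nrm f) /\
      (forall f, mem f -> 0 <= nrm f) /\
      (forall f, mem f -> (nrm f = 0 <-> ae_in I (fun x => f x = 0))) /\
      (forall u : nat -> fn, (forall n, mem (u n)) ->
         (forall e : R, 0 < e -> exists N, forall m n, (N <= m)%N -> (N <= n)%N ->
            nrm (fun x => u m x - u n x) < e) ->
         exists f, mem f /\ (fun n => nrm (fun x => u n x - f x)) @ \oo --> 0) /\
      (forall f g : fn, measurable_fun I f -> mem g ->
         ae_in I (fun x => `|f x| <= `|g x|) -> mem f /\ nrm f <= nrm g) /\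
      (exists g, mem g /\ ae_in I (fun x => 0 < g x)).

Definition distrib (I : set R) (f : fn) (l : R) : \bar R :=
  mu (I `&` [set x | l < `|f x|]).

Definition symmetric_space (I : set R) (mem : fn -> Prop) (nrm : fn -> R) : Prop :=
  banach_ideal_space I mem nrm /\
  forall f g : fn, measurable_fun I f -> measurable_fun I g ->
    (forall l, distrib I f l = distrib I g l) ->
    (mem f <-> mem g) /\ (mem f -> nrm f = nrm g).

Definition fatou_property (I : set R) (mem : fn -> Prop) (nrm : fn -> R) : Prop :=
  forall (u : nat -> fn) (f : fn), (forall n, mem (u n)) -> measurable_fun I f ->
    ae_in I (fun x => (forall n, 0 <= u n x <= u n.+1 x) /\
                      (fun n => u n x) @ \oo --> f x) ->
    (exists M : R, forall n, nrm (u n) <= M) ->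
    mem f /\ (forall n, nrm (u n) <= nrm (u n.+1)) /\
    (fun n => nrm (u n)) @ \oo --> nrm f.

Definition dual_elt (mem : fn -> Prop) (nrm : fn -> R) (phi : fn -> R) : Prop :=
  (forall f g, mem f -> mem g -> phi (fun x => f x + g x) = phi f + phi g) /\
  (forall (a : R) f, mem f -> phi (fun x => a * f x) = a * phi f) /\
  (exists K : R, forall f, mem f -> `|phi f| <= K * nrm f).

(* Bidual: bounded linear functionals on the dual (with its operator norm). *)
Definition bidual_elt (mem : fn -> Prop) (nrm : fn -> R) (Phi : (fn -> R) -> R) : Prop :=
  (forall p q, dual_elt mem nrm p -> dual_elt mem nrm q ->
     Phi (fun f => p f + q f) = Phi p + Phi q) /\
  (forall (a : R) p, dual_elt mem nrm p -> Phi (fun f => a * p f) = a * Phi p) /\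
  (exists M : R, forall p (K : R), dual_elt mem nrm p ->
     (forall f, mem f -> `|p f| <= K * nrm f) -> `|Phi p| <= M * K).

Definition reflexive_space (mem : fn -> Prop) (nrm : fn -> R) : Prop :=
  forall Phi, bidual_elt mem nrm Phi ->
    exists x, mem x /\ forall p, dual_elt mem nrm p -> Phi p = p x.

Definition dunford_pettis (mem : fn -> Prop) (nrm : fn -> R) : Prop :=
  forall (x : nat -> fn) (p : nat -> fn -> R),
    (forall n, mem (x n)) ->
    (forall q, dual_elt mem nrm q -> (fun n => q (x n)) @ \oo --> 0) ->
    (forall n, dual_elt mem nrm (p n)) ->
    (forall Phi, bidual_elt mem nrm Phi -> (fun n => Phi (p n)) @ \oo --> 0) ->
    (fun n => p n (x n)) @ \oo --> 0.

Definition kothe_mem (I : set R) (mem : fn -> Prop) (nrm : fn -> R) (g : fn) : Prop :=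
  measurable_fun I g /\
  exists M : R, forall f, mem f -> nrm f <= 1 ->
    (\int[mu]_(x in I) (`|f x * g x|)%:E <= M%:E)%E.

Definition kothe_nrm (I : set R) (mem : fn -> Prop) (nrm : fn -> R) (g : fn) : R :=
  fine (ereal_sup [set (\int[mu]_(x in I) (`|f x * g x|)%:E)%E
                  | f in [set f | mem f /\ nrm f <= 1]]).

Definition cesaro (f : fn) (x : R) : R :=
  fine (\int[mu]_(t in (`[0%R, x] : set R)) (f t)%:E) / x.

Definition copson (I : set R) (f : fn) (x : R) : R :=
  fine (\int[mu]_(t in I `&` `[x, +oo[) (f t / t)%:E).

Definition cesaro_bounded (I : set R) (mem : fn -> Prop) (nrm : fn -> R) : Prop :=
  exists M : R, forall f, mem f ->
    ae_in I (fun x => mu.-integrable `[0, x] (fun t => (f t)%:E)) /\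
    mem (cesaro f) /\ nrm (cesaro f) <= M * nrm f.

Definition copson_bounded (I : set R) (mem : fn -> Prop) (nrm : fn -> R) : Prop :=
  exists M : R, forall f, mem f ->
    ae_in I (fun x => mu.-integrable (I `&` `[x, +oo[) (fun t => (f t / t)%:E)) /\
    mem (copson I f) /\ nrm (copson I f) <= M * nrm f.

Definition CX_mem (I : set R) (mem : fn -> Prop) (f : fn) : Prop :=
  [/\ measurable_fun I f,
      ae_in I (fun x => (\int[mu]_(t in (`[0%R, x] : set R)) (`|f t|)%:E < +oo)%E) &
      mem (cesaro (fun t => `|f t|))].

Definition CX_nrm (nrm : fn -> R) (f : fn) : R := nrm (cesaro (fun t => `|f t|)).

(* decreasing majorant  f~(x) = ess sup_{t in I, t >= x} |f t|  (extended) *)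
Definition tildeE (I : set R) (f : fn) (x : R) : \bar R :=
  ereal_inf [set y : \bar R |
    mu.-negligible (I `&` (`[x, +oo[ : set R) `&` [set t | (y < (`|f t|)%:E)%E])].

Definition tilde_mem (I : set R) (mem : fn -> Prop) (f : fn) : Prop :=
  [/\ measurable_fun I f,
      ae_in I (fun x => (tildeE I f x < +oo)%E) &
      mem (fun x => fine (tildeE I f x))].

Definition tilde_nrm (I : set R) (nrm : fn -> R) (f : fn) : R :=
  nrm (fun x => fine (tildeE I f x)).

End Defs.

(* Main.v *)
(** Fix [h < 1] small enough that the indicator of ]0, h] lies in X, let
   t_n = h / 2^n, D_n = ]t_(n+1), t_n], and let c_n be the norm in X of the
   indicator of D_n.  Since C|f| is at least (int_0^(t_(n+1)) |f|) / t_n on D_n,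
   the spaces CX and X~' both look, along the blocks D_n, like sequence spaces
   over X, and both non-DP witnesses live on these blocks.

   If y_n is bounded in X and eventually vanishes on each block, an ultralimit
   of (y_n) in X** is represented by some x in X, which must be zero a.e. on the
   blocks; so y_n is weakly null.  This applies to y_n = 1_(D_(n+2)) / c_n
   (bounded by symmetry).  Applied to the truncations of a fixed x, paired with
   an ultralimit of the functionals r_n x = c_n * (mean of x over D_(n+1)), it
   gives r_n x --> 0 for every x in X.

   For CX, averaging over D_(n+1) and placing the result on D_n is a bounded map
   A : CX -> X, so Phi (r_n o A) = r_n x --> 0 for Phi in the bidual of CX and a
   suitable x in X, while y_n is weakly null in CX and r_n (A y_n) = 1.
   For X~', the adjoint-like map B sending phi in X* to the step function with
   value phi(1_(D_n)) / t_(n+1) on D_(n+1) is bounded from X* to X~', so B r_n is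
   weakly null; integration against y_n is weakly null in the dual, and the
   pairing of y_n with B r_n is 1/2. *)
Require Import Defs.
From HB Require Import structures.
From mathcomp Require Import all_boot all_order all_algebra.
From mathcomp Require Import all_classical all_reals all_analysis.
From mathcomp Require Import measurable_realfun ring lra.
Import Order.TTheory GRing.Theory Num.Theory.
Import numFieldNormedType.Exports.
Set Implicit Arguments. Unset Strict Implicit. Unset Printing Implicit Defensive.
Local Open Scope classical_set_scope.
Local Open Scope ring_scope.

(** * Ultralimits and duality *)

Section Ultralimit.
Variable R : realType.
Implicit Types (U : set_system nat) (a b : nat -> R).

(** Compactness of [-B, B] gives a cluster point of the image filter, and an ultrafilter converges
    to each of its cluster points. *)
Lemma ultra_bounded_cvg U a (B : R) : UltraFilter U ->
  (forall n, `|a n| <= B) -> cvg (a @ U).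
Proof.
move=> UU aB.
have aU : U (a @^-1` `[- B, B]%classic).
  by apply: filterE => n /=; rewrite in_itv/= -ler_norml; exact: aB.
have [l [_ cl]] := @segment_compact R (- B) B (a @ U) _ aU.
apply/cvg_ex; exists l => V nV.
have [//|UC] := in_ultra_setVsetC (a @^-1` V) UU.
have [x []] := cl (~` V) V UC nV.
by [].
Qed.

(** Some set where |a n| >= e meets every cofinite set, so the cofinite filter traced on it is
    proper and extends to an ultrafilter. Failure of convergence thus becomes an ultralimit bounded
    away from 0. *)
Lemma ultra_off0 a : ~ (a @ \oo --> 0) -> exists (U : set_system nat) (e : R),
  [/\ UltraFilter U, \oo `<=` U, 0 < e & U [set n | e <= `|a n|]].
Proof.
move=> na.
have [e e0 nae] : exists2 e : R, 0 < e & ~ \forall n \near \oo, `|a n| < e.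
  apply/not_exists2P => H; apply: na; apply/cvgr0Pnorm_lt => e e0.
  by have [|/contrapT//] := H e.
have FF : ProperFilter (within [set n | e <= `|a n|] \oo).
  apply: Build_ProperFilter_ex => B wB; apply: contrapT => nB; apply: nae.
  move: wB; rewrite /within /= => wB.
  near=> n; rewrite ltNge; apply/negP => en; apply: nB; exists n.
  by move: en; near: n.
have [U [UU sU]] := ultraFilterLemma FF.
exists U, e; split => //.
  move=> A oA; apply: sU; rewrite /within/=; exact: filterS oA.
by apply: sU; rewrite /within/=; exact: filterE.
Unshelve. all: by end_near.
Qed.

End Ultralimit.

Section Duality.
Variable R : realType.
Local Notation fn := (R -> R).
Variables (mem : fn -> Prop) (nrm : fn -> R).
Implicit Types (p q : fn -> R).

Lemma dual_eltD p q : dual_elt mem nrm p -> dual_elt mem nrm q ->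
  dual_elt mem nrm (fun f => p f + q f).
Proof.
move=> [pD [pZ [K pK]]] [qD [qZ [L qL]]]; split; [|split].
- by move=> f g mf mg; rewrite pD// qD// addrACA.
- by move=> a f mf; rewrite pZ// qZ// mulrDr.
- exists (K + L) => f mf; rewrite mulrDl.
  by apply: le_trans (ler_normD _ _) _; rewrite lerD// ?pK ?qL.
Qed.

Lemma dual_eltZ (a : R) p : dual_elt mem nrm p ->
  dual_elt mem nrm (fun f => a * p f).
Proof.
move=> [pD [pZ [K pK]]]; split; [|split].
- by move=> f g mf mg; rewrite pD// mulrDr.
- by move=> b f mf; rewrite pZ// mulrCA.
- by exists (`|a| * K) => f mf; rewrite normrM -mulrA ler_wpM2l// pK.
Qed.

(** Dual elements are functions on all of [R -> R], constrained only on [mem]. If two of them agree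
    there, their difference admits the bound K = 0, so [Phi] cannot separate them. *)
Lemma eq_bidual Phi p q : bidual_elt mem nrm Phi ->
  dual_elt mem nrm p -> dual_elt mem nrm q ->
  (forall f, mem f -> p f = q f) -> Phi p = Phi q.
Proof.
move=> [PD [PZ [M PM]]] dp dq pq.
have dq' := dual_eltZ (-1) dq.
apply/eqP; rewrite -subr_eq0 -normr_le0 -(mulr0 M) -mulN1r -PZ// -PD//.
apply: PM; first exact: dual_eltD.
by move=> f mf; rewrite pq// mulN1r subrr normr0 mul0r.
Qed.

(** The bounds K in [bidual_elt] range over all reals; multiplying inequalities by K needs its sign,
    which one function of positive norm supplies. *)
Lemma dual_bound_ge0 p (K : R) f : mem f -> 0 < nrm f ->
  (forall g, mem g -> `|p g| <= K * nrm g) -> 0 <= K.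
Proof.
move=> mf f0 pK; rewrite -(pmulr_lge0 _ f0); apply: le_trans (pK _ mf).
exact: normr_ge0.
Qed.

(** Weak-star compactness of balls of the dual, in ultralimit form. *)
Lemma ultra_dual (U : set_system nat) (r : nat -> fn -> R) (K : R) :
  UltraFilter U -> (forall n, dual_elt mem nrm (r n)) ->
  (forall n f, mem f -> `|r n f| <= K * nrm f) ->
  dual_elt mem nrm (fun f => lim ((fun n => r n f) @ U)).
Proof.
move=> UU dr rK.
have rcvg f : mem f -> cvg ((fun n => r n f) @ U).
  by move=> mf; apply: (@ultra_bounded_cvg R U _ (K * nrm f)) => n; exact: rK.
split; [|split].
- move=> f g mf mg; apply/cvg_lim => //.
  under eq_fun do rewrite (dr _).1//.
  by apply: cvgD; exact: rcvg.
- move=> a f mf; apply/cvg_lim => //.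
  under eq_fun do rewrite (dr _).2.1//.
  by apply: cvgMl_tmp; exact: rcvg.
- exists K => f mf.
  have c : cvg ((fun n => `|r n f|) @ U) by exact: is_cvg_norm (rcvg f mf).
  by rewrite -(lim_norm (rcvg f mf)); apply: (limr_le c); apply: nearW => n; exact: rK.
Qed.

(** A bounded sequence has an ultralimit in the bidual; in a reflexive space this becomes a weak
    ultralimit in the space itself. *)
Lemma ultra_bidual (U : set_system nat) (y : nat -> fn) (B : R) :
  UltraFilter U -> (forall n, mem (y n)) -> (forall f, mem f -> 0 <= nrm f) ->
  (exists f, mem f /\ 0 < nrm f) -> (forall n, nrm (y n) <= B) ->
  bidual_elt mem nrm (fun p => lim ((fun n => p (y n)) @ U)).
Proof.
move=> UU my nrm0 nrm_gt0 yB.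
have pcvg p : dual_elt mem nrm p -> cvg ((fun n => p (y n)) @ U).
  move=> [_ [_ [K pK]]]; apply: (@ultra_bounded_cvg R U _ (`|K| * B)) => n.
  apply: le_trans (pK _ (my n)) _; apply: (@le_trans _ _ (`|K| * nrm (y n))).
    by rewrite ler_wpM2r ?nrm0// ler_norm.
  by rewrite ler_wpM2l.
split; [|split].
- by move=> p q dp dq; apply/cvg_lim => //; apply: cvgD; exact: pcvg.
- move=> a p dp; apply/cvg_lim => //; apply: (@cvgMl_tmp _ _ U _ (fun n => p (y n)) a).
  exact: pcvg.
- exists B => p K dp pK.
  have c : cvg ((fun n => `|p (y n)|) @ U) by exact: is_cvg_norm (pcvg p dp).
  rewrite -(lim_norm (pcvg p dp)); apply: (limr_le c); apply: nearW => n.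
  apply: le_trans (pK _ (my n)) _; rewrite mulrC ler_wpM2r//.
  by have [f [mf f0]] := nrm_gt0; exact: (dual_bound_ge0 mf f0 pK).
Qed.
End Duality.

(** * Measure-theoretic preliminaries *)

Section AlmostEverywhere.
Variable R : realType.
Local Notation mu := (@lebesgue_measure R).
Implicit Types (I A B E : set R) (P Q : R -> Prop) (f g : R -> R).

Lemma ae_inW I P : (forall x, I x -> P x) -> ae_in I P.
Proof.
move=> IP; rewrite /ae_in (_ : _ `&` _ = set0); first exact: negligible_set0.
by apply/seteqP; split => // x [/IP].
Qed.

Lemma ae_inS I P Q : (forall x, I x -> P x -> Q x) -> ae_in I P -> ae_in I Q.
Proof.
move=> PQ; apply: negligibleS => x [Ix /= nQ]; split => // Px.
exact/nQ/PQ.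
Qed.

Lemma ae_inI I P Q : ae_in I P -> ae_in I Q -> ae_in I (fun x => P x /\ Q x).
Proof.
move=> hP hQ; have := negligibleU hP hQ; apply: negligibleS => x [Ix /= nPQ].
by have [Px|nP] := pselect (P x); [right|left]; split => //= Qx; apply: nPQ.
Qed.

Lemma ae_in_ae I P : ae_in I P -> {ae mu, forall x, I x -> P x}.
Proof.
apply: negligibleS => x /= /not_implyP[Ix nP]; by split.
Qed.

Lemma ae_in_neq I (a : R) : ae_in I (fun x => x != a).
Proof.
apply: (@negligibleS _ _ _ mu [set a]).
  by move=> x [_ /= /negP]; rewrite negbK => /eqP.
by apply/negligibleP => //; exact: lebesgue_measure_set1.
Qed.

Lemma itv_not_negligible (a b : R) : a < b -> ~ mu.-negligible `]a, b[%classic.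
Proof.
move=> ab nab; have := (negligibleP mu (measurable_itv `]a, b[)).1 nab.
rewrite /= lebesgue_measure_itv/= lte_fin ab => /eqP.
by rewrite eqe subr_eq0 gt_eqF.
Qed.

Lemma indic_equimeasurable I A B : A `<=` I -> B `<=` I -> mu A = mu B ->
  forall l, distrib I \1_A l = distrib I \1_B l.
Proof.
move=> AI BI AB l; rewrite /distrib.
have dE C : C `<=` I -> I `&` [set x | l < `|\1_C x : R|] =
    if l < 0 then I else if l < 1 then C else set0.
  move=> CI; apply/seteqP; split => [x [Ix] /=|x].
    rewrite indicE; case: ifPn => // l0; case: ifPn => l1.
      by case: (boolP (x \in C)) => [/set_mem//|_]; rewrite normr0 (negbTE l0).
    by case: (x \in C); rewrite ?normr1 ?normr0 ?(negbTE l0) ?(negbTE l1).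
  case: ifPn => l0.
    by move=> Ix; split => //=; exact: lt_le_trans l0 _.
  case: ifPn => l1// Cx; split; first exact: CI.
  by rewrite /= indicE mem_set// normr1.
by rewrite !dE//; case: ifPn => // _; case: ifPn.
Qed.

Lemma Rintegral_eq0_negligible E f : measurable E ->
  mu.-integrable E (EFin \o f) -> (forall x, E x -> f x != 0) ->
  \int[mu]_(x in E) `|f x| = 0 -> mu.-negligible E.
Proof.
move=> mE fi f0 i0.
have [mf _] := integrableP _ _ _ fi.
have : (\int[mu]_(x in E) `|(f x)%:E| = 0)%E.
  (* [fine] sends infinity to 0, so the real equation says something only once the integral is known
     to be finite. *)
  have : (\int[mu]_(x in E) `|(f x)%:E|)%E \is a fin_num.
    apply: integrable_fin_num => //; exact: integrable_abse.
  by move=> /fineK <-; congr EFin.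
move=> i0'; have := (ae_eq_integral_abs mu mE mf).1 i0'; apply: negligibleS => x Ex /=.
by move=> /(_ Ex) [] /eqP; rewrite (negbTE (f0 _ Ex)).
Qed.

End AlmostEverywhere.

Section BaseInterval.
Variable R : realType.
Local Notation mu := (@lebesgue_measure R).
Implicit Types (f g : R -> R).

(* Covers both [0, 1] and [0, oo); the point 1 is exceptional because of [0, 1],
   where [tildeE I f 1] is an infimum over all of [\bar R], hence -oo. *)
Definition base_interval (I : set R) : Prop :=
  [/\ is_interval I, `[0, 1[ `<=` I, I `<=` `[0, +oo[ &
      forall x, I x -> x != 1 -> ~ mu.-negligible (I `&` `[x, +oo[)].

Lemma base_interval_ray : base_interval `[0, +oo[.
Proof.
split => //.
- exact: interval_is_interval.
- by apply: subset_itvl.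
- move=> x /=; rewrite in_itv/= andbT => x0 _ /(@negligibleS _ _ _ mu _ `]x, (x + 1)[%classic).
  move=> H; apply: (@itv_not_negligible R x (x + 1)); first lra.
  apply: H => y /=; rewrite !in_itv/= !andbT => /andP[xy _].
  by rewrite (le_trans x0) ltW.
Qed.

Lemma base_interval_unit : base_interval `[0, 1].
Proof.
split => //.
- exact: interval_is_interval.
- by apply: subset_itvl; rewrite bnd_simp.
- by apply: subset_itvl.
- move=> x /=; rewrite in_itv/= => /andP[x0 x1] nx1.
  move=> /(@negligibleS _ _ _ mu _ `]x, 1[%classic) H.
  apply: (@itv_not_negligible R x 1); first by rewrite lt_neqAle nx1.
  apply: H => y /=; rewrite !in_itv/= andbT => /andP[xy y1].
  by rewrite (le_trans x0) ?ltW.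
Qed.

End BaseInterval.

(** * Ideal spaces *)

Section IdealSpace.
Variable R : realType.
Local Notation mu := (@lebesgue_measure R).
Variables (I : set R) (mem : (R -> R) -> Prop) (nrm : (R -> R) -> R).
Hypothesis HB : banach_ideal_space I mem nrm.
Implicit Types (f g : R -> R).

Lemma mem_measurable f : mem f -> measurable_fun I f.
Proof. by move: f; case: HB. Qed.

Lemma memD f g : mem f -> mem g -> mem (fun x => f x + g x).
Proof. by case: HB => _ [_ [H _]]; exact: H. Qed.

Lemma memZ (a : R) f : mem f -> mem (fun x => a * f x).
Proof. by case: HB => _ [_ [_ [H _]]]; exact: H. Qed.

Lemma nrmZ (a : R) f : mem f -> nrm (fun x => a * f x) = `|a| * nrm f.
Proof. by case: HB => _ [_ [_ [_ [_ [H _]]]]]; exact: H. Qed.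

Lemma nrm_ge0 f : mem f -> 0 <= nrm f.
Proof. by case: HB => _ [_ [_ [_ [_ [_ [H _]]]]]]; exact: H. Qed.

Lemma nrm_eq0 f : mem f -> (nrm f = 0 <-> ae_in I (fun x => f x = 0)).
Proof. by case: HB => _ [_ [_ [_ [_ [_ [_ [H _]]]]]]]; exact: H. Qed.

Lemma mem_le f g : measurable_fun I f -> mem g ->
  ae_in I (fun x => `|f x| <= `|g x|) -> mem f /\ nrm f <= nrm g.
Proof. by case: HB => _ [_ [_ [_ [_ [_ [_ [_ [_ [H _]]]]]]]]]; exact: H. Qed.

Lemma exists_weight : exists g, mem g /\ ae_in I (fun x => 0 < g x).
Proof. by case: HB => _ [_ [_ [_ [_ [_ [_ [_ [_ [_ H]]]]]]]]]. Qed.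

Lemma mem_norm f : mem f -> mem (fun x => `|f x|) /\ nrm (fun x => `|f x|) <= nrm f.
Proof.
move=> mf; apply: mem_le => //.
  by apply: measurableT_comp => //; exact: mem_measurable.
by apply: ae_inW => x _; rewrite normr_id.
Qed.

Lemma dual_restrict (A : set R) q : measurable A -> dual_elt mem nrm q ->
  dual_elt mem nrm (fun f => q (fun x => \1_A x * f x)).
Proof.
move=> mA [qD [qZ [K qK]]].
have mA1 f : mem f -> mem (fun x => \1_A x * f x) /\ nrm (fun x => \1_A x * f x) <= nrm f.
  move=> mf; apply: mem_le => //.
    by apply: measurable_funM; [exact: measurable_indic|exact: mem_measurable].
  apply: ae_inW => x _; rewrite normrM indicE; case: (_ \in _).
    by rewrite normr1 mul1r.
  by rewrite normr0 mul0r.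
split; [|split].
- move=> f g mf mg; rewrite -qD; [|exact: (mA1 _ _).1..].
  by congr q; apply/funext => x; rewrite mulrDr.
- move=> a f mf; rewrite -qZ; last exact: (mA1 _ _).1.
  by congr q; apply/funext => x; rewrite mulrCA.
- exists `|K| => f mf; have [mf1 nf1] := mA1 f mf.
  apply: le_trans (qK _ mf1) _.
  apply: (le_trans (ler_wpM2r (nrm_ge0 mf1) (ler_norm K))).
  by rewrite ler_wpM2l.
Qed.

End IdealSpace.

Section SmallInterval.
Variable R : realType.
Local Notation mu := (@lebesgue_measure R).

(** The weight exceeds some 1/(k+1) on a set of positive measure m inside ]0, 1[. The ideal property
    puts the indicator of that set in X, and symmetry moves it to ]0, m[. *)
Lemma symmetric_small_interval (I : set R) mem nrm :
  base_interval I -> symmetric_space I mem nrm ->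
  exists h : R, [/\ 0 < h, h < 1 & mem \1_`]0, h]].
Proof.
move=> [iI I01 _ _] [HB HS]; have mI := is_interval_measurable iI.
have [g [mg g0]] := exists_weight HB.
pose J : set R := `]0, 1[%classic.
have JI : J `<=` I by apply: subset_trans I01; apply: subset_itvr; rewrite bnd_simp.
have mgJ : measurable_fun J g.
  by apply: measurable_funS (mem_measurable HB mg).
pose E k := J `&` [set x | k.+1%:R^-1 < g x].
have mE k : measurable (E k).
  rewrite (_ : E k = J `&` g @^-1` `]k.+1%:R^-1, +oo[%classic); first by apply: mgJ; exact: measurable_itv.
  by apply/seteqP; split => x [Jx] /=; rewrite in_itv/= andbT.
have [k k0] : exists k, mu (E k) != 0%E.
  apply: contrapT => /forallNP nE.
  apply: (@itv_not_negligible R 0 1) => //.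
  have nU : mu.-negligible (\bigcup_k E k).
    apply: negligible_bigcup => k; apply: (negligibleP mu (mE k)).2.
    by have /negP := nE k; rewrite negbK => /eqP.
  apply: negligibleS (negligibleU nU g0) => x Jx.
  have [gx|ngx] := ltP 0 (g x); last first.
    by right; split; [exact: JI|rewrite /= ltNge ngx].
  left; have [k kx] := ltr_add_invr gx.
  by exists k => //; split => //=; rewrite add0r in kx.
have EJ : (mu (E k) <= 1)%E.
  have -> : (1 = mu J)%E by rewrite /J lebesgue_measure_itv/= lte_fin ltr01 oppr0 adde0.
  by apply: (@le_measure _ _ _ mu); rewrite ?inE; [exact: mE|exact: measurable_itv|exact: subIsetl].
have Efin : mu (E k) \is a fin_num by rewrite ge0_fin_numE// (le_lt_trans EJ) ?ltry.
pose m := fine (mu (E k)).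
have m0 : 0 < m by rewrite fine_gt0// lt0e k0 measure_ge0/= -ge0_fin_numE.
have m1 : m <= 1 by rewrite -lee_fin fineK.
have EI : E k `<=` I by apply: subset_trans JI => x [].
have mem1 : mem \1_(E k).
  apply: (mem_le HB _ (memZ HB k.+1%:R mg) _).1; first exact: measurable_indic.
  apply: ae_inW => x Ix; rewrite indicE; case: (boolP (x \in E k)) => [/set_mem[_ /= kx]|_].
    rewrite normr1 ler_normr; apply/orP; left.
    by rewrite -[leLHS](@mulfV _ k.+1%:R) ?pnatr_eq0// ler_wpM2l// ltW.
  by rewrite normr0.
pose F : set R := `]0, m[%classic.
have FI : F `<=` I.
  by apply: subset_trans JI; apply: subset_itvl; rewrite bnd_simp.
have memF : mem \1_F.
  have mF : measurable F by exact: measurable_itv.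
  apply: (HS \1_(E k) \1_F _ _ _).1.1 => //; [exact: measurable_indic..|].
  apply: indic_equimeasurable => //.
  by rewrite /F lebesgue_measure_itv/= lte_fin m0 oppr0 adde0 fineK.
(* Halving gives a half-open interval inside ]0, m[ and, since m <= 1, an endpoint strictly below
   1. *)
exists (m / 2); split; [lra..|].
apply: (mem_le HB _ memF _).1; first exact: measurable_indic.
apply: ae_inW => x _; rewrite !indicE; case: (boolP (x \in `]0, m / 2]%classic)) => [/set_mem/=|_]; last by rewrite normr0.
rewrite in_itv/= => /andP[x0 xm].
suff -> : x \in F by [].
by apply/mem_set; rewrite /F/= in_itv/= x0/=; lra.
Qed.

End SmallInterval.

(** * Dyadic blocks *)

Section Dyadic.
Variable R : realType.
Local Notation mu := (@lebesgue_measure R).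
Variable h : R.
Hypothesis h0 : 0 < h.
Implicit Types (m n : nat) (x : R) (a b : nat -> R).

Definition dyadic n : R := h / 2 ^+ n.
Definition dyad n : set R := `]dyadic n.+1, dyadic n]%classic.

Lemma dyadic_gt0 n : 0 < dyadic n.
Proof. by rewrite divr_gt0// exprn_gt0. Qed.

Lemma dyadicS n : dyadic n.+1 = dyadic n / 2.
Proof. by rewrite /dyadic exprSr invfM mulrA. Qed.

Lemma dyadic_le m n : (m <= n)%N -> dyadic n <= dyadic m.
Proof.
by move=> mn; rewrite ler_pM2l// lef_pV2 ?posrE ?exprn_gt0// ler_eXn2l// ltr1n.
Qed.

Lemma dyadic_lt x : 0 < x -> exists n, dyadic n < x.
Proof.
move=> x0; have : (fun n => geometric h (2^-1) n) @ \oo --> (0 : R).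
  by apply: cvg_geometric; rewrite ger0_norm// invf_lt1// ltr1n.
move=> /cvgr0Pnorm_lt /(_ _ x0) [n _ /(_ n (leqnn n))] /=.
rewrite exprVn => /ltr_normlP[_ nx]; by exists n.
Qed.

Lemma dyad_cover x : 0 < x -> x <= h -> exists n, dyad n x.
Proof.
move=> x0 xh; have ex := dyadic_lt x0.
case: (ex_minnP ex) => -[|n] nx nmin.
  by move: nx; rewrite /dyadic expr0 divr1 ltNge xh.
exists n; rewrite /dyad/= in_itv/= nx/= leNgt; apply/negP => /nmin.
by rewrite ltnn.
Qed.

Lemma dyad_inj m n x : dyad m x -> dyad n x -> m = n.
Proof.
suff H i j : dyad i x -> dyad j x -> (i <= j)%N.
  by move=> dm dn; apply/eqP; rewrite eqn_leq !H.
rewrite /dyad/= !in_itv/= => /andP[_ xi] /andP[jx _].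
rewrite leqNgt; apply/negP => /dyadic_le ij.
by have := lt_le_trans jx (le_trans xi ij); rewrite ltxx.
Qed.

Lemma dyad_sub m n x : (m <= n)%N -> dyad n x -> 0 < x <= dyadic m.
Proof.
move=> mn; rewrite /dyad/= in_itv/= => /andP[nx xn].
by rewrite (lt_trans (dyadic_gt0 n.+1) nx)/= (le_trans xn)// dyadic_le.
Qed.

Lemma measurable_dyad n : measurable (dyad n).
Proof. exact: measurable_itv. Qed.

Lemma measure_dyad n : mu (dyad n) = (dyadic n.+1)%:E.
Proof.
have n0 := dyadic_gt0 n; rewrite /dyad lebesgue_measure_itv/= lte_fin dyadicS ifT; last lra.
by rewrite -EFinB; congr EFin; lra.
Qed.

(** [xget] selects the index of the block containing x, unique by [dyad_inj]; where there is no
    block, its default index 0 is masked by the indicator. *)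
Definition step a x : R := \1_`]0, h] x * a (xget 0%N [set n | dyad n x]).

Lemma step_dyad a n x : dyad n x -> step a x = a n.
Proof.
move=> nx; rewrite /step indicE mem_set; last first.
  have := dyad_sub (leq0n n) nx; rewrite /dyadic expr0 divr1.
  by rewrite /= in_itv.
rewrite mul1r; congr a; apply: (dyad_inj _ nx).
by apply: (@xgetPex _ 0%N [set n | dyad n x]); exists n.
Qed.

Lemma step_out a x : ~ (0 < x <= h) -> step a x = 0.
Proof.
by move=> nx; rewrite /step indicE memNset ?mul0r//= in_itv.
Qed.

Variant step_spec a x : R -> Prop :=
| StepIn n of dyad n x : step_spec a x (a n)
| StepOut of ~ (0 < x <= h) : step_spec a x 0.

Lemma stepP a x : step_spec a x (step a x).
Proof.
have [/andP[x0 xh]|nx] := pselect (0 < x <= h); last by rewrite step_out//; constructor.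
by have [n nx] := dyad_cover x0 xh; rewrite (step_dyad _ nx); constructor.
Qed.

Lemma measurable_step a (I : set R) : measurable I -> measurable_fun I (step a).
Proof.
move=> mI; apply: (@measurable_funS _ _ _ _ setT) => //.
pose P : set R := \bigcup_n dyad n.
have mP : measurable P by apply: bigcup_measurable => n _; exact: measurable_dyad.
rewrite -(setUv P) measurable_funU//; last exact: measurableC.
split.
  apply/measurable_fun_bigcup => [i|n]; first exact: measurable_dyad.
  apply: (eq_measurable_fun (cst (a n))); last exact: measurable_cst.
  by move=> x /set_mem nx; rewrite (step_dyad _ nx).
apply: (eq_measurable_fun (cst (0 : R))); last exact: measurable_cst.
by move=> x /set_mem Px; case: stepP => // n nx; case: Px; exists n.
Qed.

Lemma stepD a b x : step (fun n => a n + b n) x = step a x + step b x.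
Proof. by rewrite /step mulrDr. Qed.

Lemma stepZ (k : R) a x : step (fun n => k * a n) x = k * step a x.
Proof. by rewrite /step mulrCA. Qed.

End Dyadic.

(** * Decreasing majorants and the Köthe dual *)

Section DecreasingMajorant.
Variable R : realType.
Local Notation mu := (@lebesgue_measure R).
Variable I : set R.
Hypothesis HI : base_interval I.
Implicit Types (f : R -> R) (x y : R).

Let mI : measurable I. Proof. by case: HI => /is_interval_measurable. Qed.

Lemma negligible_countable_bigcup (T : countType) (F : T -> set R) :
  (forall i, mu.-negligible (F i)) -> mu.-negligible (\bigcup_i F i).
Proof.
move=> FN.
have UN : mu.-negligible (\bigcup_k (if unpickle k is Some i then F i else set0)).
  apply: negligible_bigcup => k.
  by case: (unpickle k) => [i|]; [exact: FN|exact: negligible_set0].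
by apply: negligibleS UN => s [i _ Fs]; exists (pickle i); rewrite // pickleK.
Qed.

Lemma tildeE_le f x y : x <= y -> (tildeE I f y <= tildeE I f x)%E.
Proof.
move=> xy; apply: ereal_inf_le_tmp => z /=; apply: negligibleS => s [[Is]].
rewrite /= !in_itv/= !andbT => ys zs; split => //; split => //=.
exact: le_trans xy ys.
Qed.

(** The majorant is nonincreasing, so its superlevel sets are order-convex, hence measurable. *)
Lemma measurable_tilde f : measurable_fun I (fun x => fine (tildeE I f x)).
Proof.
apply: (measurableT_comp (f := fine)); first exact: fine_measurable.
apply: (measurability _ (ErealGenOInfty.measurableE R)) => _ /= -[_ [r ->] <-].
apply: measurableI => //; apply: is_interval_measurable => s u /=.
rewrite !in_itv/= !andbT => fs fu v /andP[sv vu].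
by rewrite /mkset /preimage /= ?in_itv/= ?andbT (lt_le_trans fu)// tildeE_le.
Qed.

(** A negative admissible bound would make all of I beyond x negligible. *)
Lemma tildeE_ge0 f x : I x -> x != 1 -> (0 <= tildeE I f x)%E.
Proof.
case: HI => _ _ _ nI Ix x1; apply/ereal_infP => y /= yneg.
rewrite leNgt; apply/negP => y0; apply: (nI x) => //.
apply: negligibleS yneg => s [Is xs]; split => //=.
by apply: (lt_le_trans y0); rewrite lee_fin.
Qed.

(** If the majorant at s is below |f s|, a rational q separates them. The set [Z q] where the
    majorant is below q is upward closed in I, and beyond each of its points |f| <= q almost
    everywhere. Either some rational of [Z q] lies below s, or s is the minimum of [Z q]; so the bad
    points lie in countably many null sets. *)
Lemma ae_le_tilde f : ae_in I (fun x => (`|f x|%:E <= tildeE I f x)%E).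
Proof.
pose Z (q : rat) x := I x /\ (tildeE I f x < (ratr q : R)%:E)%E.
pose F (qr : rat * rat) : set R :=
  [set s | [/\ Z qr.1 (ratr qr.2), I s, ratr qr.2 <= s & ratr qr.1 < `|f s|]] `|`
  [set s | Z qr.1 s /\ forall x, Z qr.1 x -> s <= x].
have ZN q x : Z q x ->
    mu.-negligible (I `&` `[x, +oo[ `&` [set s | ratr q < `|f s|]).
  move=> [Ix]; rewrite /tildeE => /ereal_inf_lt[y /= yneg yq].
  apply: negligibleS yneg => s [[Is xs] /= qs]; split => //=.
  by apply: (lt_trans yq); rewrite lte_fin.
have FN qr : mu.-negligible (F qr).
  apply: negligibleU.
    have [Zqr|nZ] := pselect (Z qr.1 (ratr qr.2)).
      apply: negligibleS (ZN _ _ Zqr) => s [_ Is rs qs]; split => //; split => //=.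
      by rewrite in_itv/= andbT.
    by apply: (@negligibleS _ _ _ mu set0) => [s []//|]; exact: negligible_set0.
  have [[s0 [Zs0 s0min]]|nmin] := pselect (exists s, Z qr.1 s /\ forall x, Z qr.1 x -> s <= x).
    apply: (@negligibleS _ _ _ mu [set s0]).
      move=> s [Zs smin] /=; apply/eqP; rewrite eq_le smin//=; exact: s0min.
    by apply: (negligibleP mu (measurable_set1 s0)).2; exact: lebesgue_measure_set1.
  apply: (@negligibleS _ _ _ mu set0) => [s ss|]; last exact: negligible_set0.
  by apply: nmin; exists s.
have UN := negligible_countable_bigcup FN.
apply: negligibleS (negligibleU UN (ae_in_neq I 1)) => s [Is /= /negP].
rewrite -ltNge => fs; have [s1|s1] := eqVneq s 1.
  by right; split => //=; rewrite s1 eqxx.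
left.
have t0 := tildeE_ge0 f Is s1.
have tfin : tildeE I f s \is a fin_num.
  by rewrite ge0_fin_numE// (lt_trans fs) ?ltry.
have [q] : exists q : rat, ratr q \in `]fine (tildeE I f s), `|f s|[.
  by apply: rat_in_itvoo; rewrite -lte_fin fineK.
rewrite in_itv/= => /andP[sq qs].
have Zs : Z q s by split => //; rewrite -(fineK tfin) lte_fin.
have [[x [Zx xs]]|nx] := pselect (exists x, Z q x /\ x < s).
  have [r] := rat_in_itvoo xs; rewrite in_itv/= => /andP[xr rs].
  have Zr : Z q (ratr r).
    split; last by apply: le_lt_trans Zx.2; apply: tildeE_le; exact: ltW.
    case: HI => iI _ _ _; apply: (iI x s) => //; first by case: Zx.
    by rewrite !ltW.
  exists (q, r) => //; left; split => //=; exact: ltW.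
exists (q, q) => //; right; split => //= x Zx.
by rewrite leNgt; apply/negP => xs; apply: nx; exists x.
Qed.

End DecreasingMajorant.

(** * Hölder inequalities and the pairing of X with the Tandori space *)

Section Kothe.
Variable R : realType.
Local Notation mu := (@lebesgue_measure R).
Variables (I : set R) (mem : (R -> R) -> Prop) (nrm : (R -> R) -> R).
Hypothesis HI : base_interval I.
Hypothesis HB : banach_ideal_space I mem nrm.
Implicit Types (f g : R -> R).
Local Notation kmem := (kothe_mem I mem nrm).
Local Notation knrm := (kothe_nrm I mem nrm).

Let mI : measurable I. Proof. by case: HI => /is_interval_measurable. Qed.

Let pairings g := [set (\int[mu]_(x in I) (`|f x * g x|)%:E)%E
  | f in [set f | mem f /\ nrm f <= 1]].

Lemma kothe_sup_ge0 g : (0 <= ereal_sup (pairings g))%E.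
Proof.
have mem0 : mem (fun=> 0) by case: HB => _ [].
apply: le_ereal_sup_tmp.
exists (\int[mu]_(x in I) (`|0 * g x|)%:E)%E; last by apply: integral_ge0.
exists (fun=> 0) => //; split => //.
by rewrite ((nrm_eq0 HB mem0).2 _) ?ler01//; exact: ae_inW.
Qed.

Lemma kothe_nrmE g : kmem g -> (knrm g)%:E = ereal_sup (pairings g).
Proof.
move=> [_ [B gB]]; apply: fineK; rewrite ge0_fin_numE ?kothe_sup_ge0//.
apply: (@le_lt_trans _ _ B%:E); last exact: ltry.
by apply: ge_ereal_sup => _ [f [mf nf] <-]; exact: gB.
Qed.

Lemma kothe_nrm_ge0 g : 0 <= knrm g.
Proof. by apply: fine_ge0; exact: kothe_sup_ge0. Qed.

Lemma kothe_nrm_le g (B : R) : measurable_fun I g ->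
  (forall f, mem f -> nrm f <= 1 ->
    (\int[mu]_(x in I) (`|f x * g x|)%:E <= B%:E)%E) ->
  kmem g /\ knrm g <= B.
Proof.
move=> mg gB; have kg : kmem g by split => //; exists B.
split => //; rewrite -lee_fin kothe_nrmE//.
by apply: ge_ereal_sup => _ [f [mf nf] <-]; exact: gB.
Qed.

Let mpairing f g : mem f -> measurable_fun I g ->
  measurable_fun I (fun x => (`|f x * g x|)%:E).
Proof.
move=> mf mg; apply/measurable_EFinP; apply: measurableT_comp => //.
by apply: measurable_funM => //; exact: (mem_measurable HB).
Qed.

Lemma kothe_holder f g : mem f -> kmem g ->
  (\int[mu]_(x in I) (`|f x * g x|)%:E <= (nrm f * knrm g)%:E)%E.
Proof.
move=> mf kg; have [mg _] := kg.
have [f0|f0] := eqVneq (nrm f) 0.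
  have ae0 := (nrm_eq0 HB mf).1 f0.
  apply: (@le_trans _ _ (\int[mu]_(x in I) (0 : \bar R))%E); last first.
    by rewrite integral0 f0 mul0r.
  apply: ae_ge0_le_integral => //; first exact: mpairing.
  apply: ae_in_ae; apply: ae_inS ae0 => x Ix fx.
  by rewrite fx mul0r normr0.
have nf : 0 < nrm f by rewrite lt_def f0 (nrm_ge0 HB).
have mf1 : mem (fun x => (nrm f)^-1 * f x) by exact: (memZ HB).
have nf1 : nrm (fun x => (nrm f)^-1 * f x) <= 1.
  by rewrite (nrmZ HB)// gtr0_norm ?invr_gt0// mulVf.
have : (\int[mu]_(x in I) (`|(nrm f)^-1 * f x * g x|)%:E <= (knrm g)%:E)%E.
  by rewrite kothe_nrmE//; apply: ereal_sup_ubound; exists (fun x => (nrm f)^-1 * f x).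
have -> : (\int[mu]_(x in I) (`|(nrm f)^-1 * f x * g x|)%:E =
    ((nrm f)^-1)%:E * \int[mu]_(x in I) (`|f x * g x|)%:E)%E.
  rewrite -ge0_integralZl_EFin//; [|exact: mpairing|by rewrite invr_ge0 ltW].
  apply: eq_integral => x _; rewrite -EFinM -mulrA normrM gtr0_norm//.
  by rewrite invr_gt0.
by rewrite muleC lee_pdivrMr// EFinM muleC.
Qed.

Local Notation TX := (tilde_mem I kmem).
Local Notation nTX := (tilde_nrm I knrm).

(** Almost everywhere |g| lies below its decreasing majorant, which belongs to the Köthe dual, so
    [kothe_holder] applies to the majorant. *)
Lemma tilde_holder f g : mem f -> TX g ->
  (\int[mu]_(x in I) (`|f x * g x|)%:E <= (nrm f * nTX g)%:E)%E.
Proof.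
move=> mf [mg gfin kg]; have [mt _] := kg.
apply: le_trans (kothe_holder mf kg).
apply: ae_ge0_le_integral => //; [exact: mpairing..|].
have := ae_inI (ae_inI gfin (ae_le_tilde HI g)) (ae_in_neq I 1).
move=> H; apply: ae_in_ae; apply: ae_inS H => x Ix [[xfin gx] x1].
have t0 := tildeE_ge0 HI g Ix x1.
rewrite lee_fin !normrM ler_wpM2l// -lee_fin (le_trans gx)//.
rewrite -[leLHS]fineK ?ge0_fin_numE//.
by rewrite lee_fin ler_norm.
Qed.

Definition pairing f g : R := \int[mu]_(x in I) (f x * g x).

Lemma pairing_integrable f g : mem f -> TX g ->
  mu.-integrable I (EFin \o (fun x => f x * g x)).
Proof.
move=> mf Tg; apply/integrableP; split.
  apply/measurable_EFinP; apply: measurable_funM; first exact: (mem_measurable HB).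
  by case: Tg.
by apply: le_lt_trans (tilde_holder mf Tg) _; exact: ltry.
Qed.

Lemma pairing_le f g : mem f -> TX g -> `|pairing f g| <= nrm f * nTX g.
Proof.
move=> mf Tg; have fgi := pairing_integrable mf Tg.
apply: (le_trans (le_normr_Rintegral _ fgi)) => //.
rewrite -lee_fin /Rintegral fineK; first exact: tilde_holder.
by apply: integrable_fin_num => //; exact: integrable_norm fgi.
Qed.

Lemma pairing_dual f : mem f -> dual_elt TX nTX (pairing f).
Proof.
move=> mf; split; [|split].
- move=> g1 g2 T1 T2; rewrite /pairing -RintegralD//; try exact: pairing_integrable.
  by apply: eq_Rintegral => x _; rewrite mulrDr.
- move=> a g Tg; rewrite /pairing -RintegralZl//; last exact: pairing_integrable.
  by apply: eq_Rintegral => x _; rewrite mulrCA.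
- by exists (nrm f) => g Tg; exact: pairing_le.
Qed.

(** Pulling [Phi] back to the dual of X lets weak nullity of a sequence in X pass to the functionals
    it induces by integration. *)
Lemma pairing_adjoint Phi : bidual_elt TX nTX Phi ->
  dual_elt mem nrm (fun f => Phi (pairing f)).
Proof.
move=> bP; have [PD [PZ [L PL]]] := bP.
split; [|split].
- move=> f g mf mg; have df := pairing_dual mf; have dg := pairing_dual mg.
  (* The functionals are compared only on the Tandori space, where the products are integrable; this
     is enough for [eq_bidual]. *)
  rewrite -PD//; apply: (eq_bidual bP); first exact/pairing_dual/(memD HB).
    exact: dual_eltD.
  move=> g1 T1; rewrite /pairing -RintegralD//; try exact: pairing_integrable.
  by apply: eq_Rintegral => x _; rewrite mulrDl.
- move=> a f mf; have df := pairing_dual mf.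
  rewrite -PZ//; apply: (eq_bidual bP); first exact/pairing_dual/(memZ HB).
    exact: dual_eltZ.
  move=> g1 T1; rewrite /pairing -RintegralZl//; last exact: pairing_integrable.
  by apply: eq_Rintegral => x _; rewrite mulrA.
- exists L => f mf; apply: PL; first exact: pairing_dual.
  by move=> g Tg; exact: pairing_le.
Qed.

End Kothe.

(** * Blocks in Cesàro and Tandori spaces *)

Section Cesaro.
Variable R : realType.
Local Notation mu := (@lebesgue_measure R).
(* [sequences] also exports a [cesaro]. *)
Local Notation cesaro := Defs.cesaro.
Variables (I : set R) (mem : (R -> R) -> Prop) (nrm : (R -> R) -> R).
Hypothesis HI : base_interval I.
Hypothesis HS : symmetric_space I mem nrm.
Variables (h M : R).
Hypotheses (h0 : 0 < h) (h1 : h < 1) (memh : mem \1_`]0, h]).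
Hypothesis HM : forall f, mem f ->
  ae_in I (fun x => mu.-integrable `[0, x] (fun t => (f t)%:E)) /\
  mem (cesaro f) /\ nrm (cesaro f) <= M * nrm f.
Implicit Types (f g : R -> R) (n m : nat).
Local Notation t := (dyadic h).
Local Notation D := (dyad h).
Local Notation chi n := (\1_(D n) : R -> R).
Local Notation c n := (nrm (chi n)).
Local Notation CX := (CX_mem I mem).
Local Notation nCX := (CX_nrm nrm).

Let HB := HS.1.
Let mI : measurable I. Proof. by case: HI => /is_interval_measurable. Qed.
Let I01 : `[0, 1[ `<=` I. Proof. by case: HI. Qed.

(** * Block indicators and their norms *)

Lemma dyadic_lt1 n : t n < 1.
Proof.
by apply: le_lt_trans h1; apply: le_trans (dyadic_le h0 (leq0n n)) _;
  rewrite /dyadic expr0 divr1.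
Qed.

Lemma dyad_subI n : D n `<=` I.
Proof.
move=> x /(dyad_sub h0 (leqnn n)) /andP[x0 xn]; apply: I01.
by rewrite /= in_itv/= (ltW x0) (le_lt_trans xn)// dyadic_lt1.
Qed.

Lemma mem_chi n : mem (chi n).
Proof.
apply: (mem_le HB _ memh _).1; first by apply: measurable_indic; exact: measurable_dyad.
apply: ae_inW => x _; rewrite !indicE.
case: (boolP (x \in D n)) => [/set_mem nx|_]; last by rewrite normr0.
suff -> : x \in `]0, h]%classic by [].
apply/mem_set; have := dyad_sub h0 (leq0n n) nx.
by rewrite /dyadic expr0 divr1 /= in_itv.
Qed.

Lemma nrm_chi_gt0 n : 0 < c n.
Proof.
rewrite lt_def (nrm_ge0 HB (mem_chi n)) andbT.
apply/eqP => /(nrm_eq0 HB (mem_chi n)) n0.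
apply: (@itv_not_negligible R (t n.+1) (t n)).
  by have := dyadic_gt0 h0 n; rewrite dyadicS; lra.
apply: negligibleS n0 => x nx.
have Dx : D n x by move: nx; rewrite /dyad/= !in_itv/= => /andP[-> /ltW].
split; first exact: dyad_subI Dx.
by rewrite /= indicE mem_set//; apply/eqP; rewrite oner_eq0.
Qed.

(** [D n] contains an interval [F] of length t n.+3, the length of [D n.+2]; by symmetry its
    indicator has norm [c n.+2]. *)
Lemma nrm_chi_le n : c n.+2 <= c n.
Proof.
have n0 := dyadic_gt0 h0 n.
pose F : set R := `]t n.+1, t n.+1 + t n.+3]%classic.
have mF : measurable F by exact: measurable_itv.
have FD : F `<=` D n.
  by apply: subset_itvl; rewrite bnd_simp !dyadicS; lra.
have [mFm <-] : mem \1_F /\ nrm \1_F = c n.+2.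
  have [|||mm nn] := HS.2 (chi n.+2) \1_F.
  - by apply: measurable_indic; exact: measurable_dyad.
  - exact: measurable_indic.
  - apply: indic_equimeasurable; first exact: dyad_subI.
      by apply: subset_trans FD _; exact: dyad_subI.
    rewrite measure_dyad// /F lebesgue_measure_itv/= lte_fin !dyadicS ifT; last lra.
    by rewrite -EFinB; congr EFin; lra.
  split; first by apply/mm; exact: mem_chi.
  by rewrite nn//; exact: mem_chi.
apply: (mem_le HB _ (mem_chi n) _).2; first exact: measurable_indic.
apply: ae_inW => x _; rewrite !indicE.
case: (boolP (x \in F)) => [/set_mem Fx|_]; last by rewrite normr0.
by rewrite mem_set//; exact: FD.
Qed.

(** * Local integral bounds in the Cesàro space *)

(** Membership in [CX] gives finiteness only for almost every endpoint. Some good endpoint y lies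
    between x and 1, and the integral increases with the endpoint. The maximum with 0 keeps y in
    I. *)
Lemma CX_finite f x : CX f -> x < 1 ->
  (\int[mu]_(s in (`[0%R, x] : set R)) (`|f s|)%:E < +oo)%E.
Proof.
move=> [mf fae _] x1; pose z := Order.max 0 x.
have z1 : z < 1 by rewrite gt_max x1 ltr01.
have [y [zy y1 fy]] : exists y, [/\ z < y, y < 1 &
    (\int[mu]_(s in (`[0%R, y] : set R)) (`|f s|)%:E < +oo)%E].
  apply: contrapT => /forallNP ny; apply: (@itv_not_negligible R z 1) => //.
  apply: negligibleS fae => y; rewrite /= in_itv/= => /andP[zy y1]; split.
    by apply: I01; rewrite /= in_itv/= y1 andbT (le_trans _ (ltW zy))// le_max lexx.
  by move=> yoo; apply: (ny y).
apply: le_lt_trans fy; apply: ge0_subset_integral => //.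
- apply: measurable_funS mI _ _; last first.
    by apply/measurable_EFinP; apply: measurableT_comp => //; exact: mf.
  move=> s /=; rewrite in_itv/= => /andP[s0 sy]; apply: I01.
  by rewrite /= in_itv/= s0 (le_lt_trans sy).
- apply: subset_itvl; rewrite bnd_simp ltW// (le_lt_trans _ zy)//.
  by rewrite le_max lexx orbT.
Qed.

Lemma CX_integrable f x : CX f -> x < 1 -> mu.-integrable `[0, x] (EFin \o f).
Proof.
move=> Cf x1; apply/integrableP; split.
  apply/measurable_EFinP; apply: measurable_funS mI _ _; last by case: Cf.
  move=> s /=; rewrite in_itv/= => /andP[s0 sx]; apply: I01.
  by rewrite /= in_itv/= s0 (le_lt_trans sx).
exact: CX_finite.
Qed.

Definition mass f n : R := \int[mu]_(x in `[0, t n]) `|f x|.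

Lemma mass_ge0 f n : 0 <= mass f n.
Proof. by apply: Rintegral_ge0. Qed.

(** For x in [D n], the interval [0, x] contains [0, t n.+1], and 1 / x >= 1 / t n. *)
Lemma cesaro_ge f n x : CX f -> D n x ->
  mass f n.+1 / t n <= cesaro (fun s => `|f s|) x.
Proof.
move=> Cf; rewrite /dyad/= in_itv/= => /andP[nx xn].
have n0 := dyadic_gt0 h0 n.
have nS0 := dyadic_gt0 h0 n.+1.
have x0 : 0 < x by exact: lt_trans nx.
have x1 : x < 1 by exact: le_lt_trans xn (dyadic_lt1 n).
have fabs y : y < 1 -> mu.-integrable `[0, y] (EFin \o (fun s => `|f s|)).
  by move=> y1; exact: integrable_norm (CX_integrable Cf y1).
have le1 : mass f n.+1 <= \int[mu]_(s in `[0, x]) `|f s|.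
  have ffin y : y < 1 -> (\int[mu]_(s in `[0%R, y]) `|f s|%:E)%E \is a fin_num.
    by move=> y1; apply: integrable_fin_num => //; exact: fabs.
  rewrite -lee_fin /mass /Rintegral !fineK ?ffin ?dyadic_lt1//.
  apply: ge0_subset_integral => //.
  - by have /integrableP[] := fabs _ x1.
  - by apply: subset_itvl; rewrite bnd_simp ltW.
rewrite /cesaro; apply: (@le_trans _ _ (mass f n.+1 / x)).
  by rewrite ler_wpM2l ?mass_ge0// lef_pV2 ?posrE.
by rewrite ler_pM2r ?invr_gt0.
Qed.

Lemma CX_ge f n : CX f -> c n * (mass f n.+1 / t n) <= nCX f.
Proof.
move=> Cf; have [_ _ mCf] := Cf.
have n0 := dyadic_gt0 h0 n.
have m0 : 0 <= mass f n.+1 / t n by rewrite divr_ge0 ?mass_ge0// ltW.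
rewrite -{1}(ger0_norm m0) mulrC -(nrmZ HB); last exact: mem_chi.
apply: (mem_le HB _ mCf _).2.
  by apply: measurable_funM => //; apply: measurable_indic; exact: measurable_dyad.
apply: ae_inW => x _; rewrite indicE.
case: (boolP (x \in D n)) => [/set_mem nx|_]; last by rewrite mulr0 normr0.
rewrite mulr1 ger0_norm// ler_normr; apply/orP; left.
exact: cesaro_ge.
Qed.

Lemma setint_mass f n (E : set R) : CX f -> measurable E -> E `<=` `[0, t n] ->
  `|\int[mu]_(x in E) f x| <= mass f n.
Proof.
move=> Cf mE EI; have fi := CX_integrable Cf (dyadic_lt1 n).
have fE : mu.-integrable E (EFin \o f) by apply: integrableS fi.
apply: (le_trans (le_normr_Rintegral _ fE)) => //.
have ffin F : measurable F -> mu.-integrable F (EFin \o f) ->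
    (\int[mu]_(s in F) `|f s|%:E)%E \is a fin_num.
  by move=> mF fF; apply: integrable_fin_num => //; exact: integrable_norm fF.
rewrite -lee_fin /mass /Rintegral !fineK ?ffin//.
apply: ge0_subset_integral => //.
by have /integrableP[] := integrable_norm fi.
Qed.

(* The weight is read off from [CX_ge], so functionals supported below [t 1] are
   bounded on CX although CX need not embed in L^1 when I = [0, 1]. *)
Lemma setint_le f n (E : set R) : CX f -> measurable E -> E `<=` `[0, t n.+1] ->
  `|\int[mu]_(x in E) f x| <= t n / c n * nCX f.
Proof.
move=> Cf mE EI; apply: le_trans (setint_mass Cf mE EI) _.
have := CX_ge n Cf; have c0 := nrm_chi_gt0 n; have n0 := dyadic_gt0 h0 n.
rewrite mulrA ler_pdivrMr// [t n / _ * _]mulrAC ler_pdivlMr//.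
by rewrite [c n * _]mulrC [nCX f * _]mulrC.
Qed.

Lemma setint_dual_CX n (E : set R) : measurable E -> E `<=` `[0, t n.+1] ->
  dual_elt CX nCX (fun f => \int[mu]_(x in E) f x).
Proof.
move=> mE EI.
have fE f : CX f -> mu.-integrable E (EFin \o f).
  by move=> Cf; apply: integrableS (CX_integrable Cf (dyadic_lt1 n.+1)).
split; [|split].
- by move=> f g Cf Cg; rewrite RintegralD//; exact: fE.
- by move=> a f Cf; rewrite RintegralZl//; exact: fE.
- by exists (t n / c n) => f Cf; exact: setint_le.
Qed.

Lemma cesaro_bound_ge0 : 0 <= M.
Proof.
have [_ [mC nC]] := HM (mem_chi 0).
by rewrite -(pmulr_lge0 _ (nrm_chi_gt0 0)) (le_trans (nrm_ge0 HB mC)).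
Qed.

(** Boundedness of C is continuity of the embedding of X into [CX]; functionals on [CX] thereby
    restrict to X. *)
Lemma mem_CX f : mem f -> CX f /\ nCX f <= M * nrm f.
Proof.
move=> mf; have [mf' nf'] := mem_norm HB mf.
have [fi [mC nC]] := HM mf'; split.
  split => //; first exact: mem_measurable HB _ mf.
  apply: ae_inS fi => x _ /integrableP[_].
  by under eq_integral do rewrite /= normr_id.
apply: (le_trans nC).
by rewrite ler_wpM2l// cesaro_bound_ge0.
Qed.

Lemma dual_CX_mem q : dual_elt CX nCX q -> dual_elt mem nrm q.
Proof.
move=> [qD [qZ [K qK]]]; split; [|split].
- by move=> f g /mem_CX[Cf _] /mem_CX[Cg _]; exact: qD.
- by move=> a f /mem_CX[Cf _]; exact: qZ.
- exists (`|K| * M) => f mf; have [Cf nf] := mem_CX mf.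
  apply: le_trans (qK _ Cf) _; rewrite -mulrA.
  have n0 : 0 <= nCX f by apply: nrm_ge0 HB _ _; case: Cf.
  by apply: (le_trans (ler_wpM2r n0 (ler_norm K))); rewrite ler_wpM2l.
Qed.

(** * Weakly null sequences in the reflexive space X *)

Hypothesis refX : reflexive_space mem nrm.

Lemma setint_dual n (E : set R) : measurable E -> E `<=` `[0, t n.+1] ->
  dual_elt mem nrm (fun f => \int[mu]_(x in E) f x).
Proof. by move=> mE EI; exact/dual_CX_mem/(setint_dual_CX mE EI). Qed.

Lemma dyad_sub_itv m n : (m <= n)%N -> D n `<=` `[0, t m].
Proof.
move=> mn x /(dyad_sub h0 mn) /andP[x0 xm].
by rewrite /= in_itv/= (ltW x0).
Qed.

Lemma mem_integrable f (E : set R) : mem f -> measurable E ->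
  E `<=` `[0, t 1] -> mu.-integrable E (EFin \o f).
Proof.
move=> /mem_CX[Cf _] mE EI.
by apply: integrableS (CX_integrable Cf (dyadic_lt1 1)).
Qed.

(** If q (y n) stays away from 0 along an ultrafilter, reflexivity represents the ultralimit of y by
    some x. Integrals over parts of blocks show that x vanishes almost everywhere on ]0, t 1], which
    contradicts the value of q. *)
Lemma vanishing_weakly_null (y : nat -> R -> R) (B : R) q :
  (forall n, mem (y n)) -> (forall n, nrm (y n) <= B) ->
  (forall n x, ~ (0 < x <= t 1) -> y n x = 0) ->
  (forall m, \forall n \near \oo, forall x, D m.+1 x -> y n x = 0) ->
  dual_elt mem nrm q -> (fun n => q (y n)) @ \oo --> 0.
Proof.
move=> my yB ysupp ynear dq; apply: contrapT => /ultra_off0[U [e [UU oU e0 Ue]]].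
have bU : bidual_elt mem nrm (fun p => lim ((fun n => p (y n)) @ U)).
  apply: (@ultra_bidual _ _ _ U y B) => //; first by move=> f; exact: (nrm_ge0 HB).
  by exists (chi 0); split; [exact: mem_chi|exact: nrm_chi_gt0].
have [x [mx px]] := refX bU.
have mxI := mem_measurable HB mx.
(* Integration over E belongs to the dual and is eventually 0 along y, so it is 0 at x. *)
have int0 m (E : set R) : measurable E -> E `<=` D m.+1 -> \int[mu]_(s in E) x s = 0.
  move=> mE ED; rewrite -(px (fun f => \int[mu]_(s in E) f s)); last first.
    by apply: (@setint_dual 0) => //; apply: subset_trans ED (dyad_sub_itv _).
  apply/cvg_lim => //; apply: cvg_near_cst; apply: oU.
  move: (ynear m); apply: filterS => n y0.
  transitivity (\int[mu]_(s in E) (0 : R)).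
    by apply: eq_Rintegral => s /set_mem /ED; exact: y0.
  by rewrite Rintegral_cst// mul0r.
have x0m m : mu.-negligible (D m.+1 `&` [set s | x s != 0]).
  have mxD : measurable_fun (D m.+1) x by apply: measurable_funS (mxI) => //; exact: dyad_subI.
  have mD := measurable_dyad h m.+1.
  (* Zero integrals over the positivity and negativity sets of x make both sets null. *)
  pose Ep := D m.+1 `&` x @^-1` `]0, +oo[%classic.
  pose En := D m.+1 `&` x @^-1` `]-oo, 0[%classic.
  have mEp : measurable Ep by apply: mxD => //; exact: measurable_itv.
  have mEn : measurable En by apply: mxD => //; exact: measurable_itv.
  have xi (E : set R) : measurable E -> E `<=` D m.+1 -> mu.-integrable E (EFin \o x).
    by move=> mE ED; apply: mem_integrable => //; exact: subset_trans ED (dyad_sub_itv _).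
  have nEp : mu.-negligible Ep.
    apply: (@Rintegral_eq0_negligible R _ x) => //; first by apply: xi => // s [].
      by move=> s [_]; rewrite /= in_itv/= andbT => /gt_eqF ->.
    rewrite -(int0 m Ep) => //; last by move=> s [].
    apply: eq_Rintegral => s /set_mem[_]; rewrite /= in_itv/= andbT => s0.
    by rewrite gtr0_norm.
  have nEn : mu.-negligible En.
    apply: (@Rintegral_eq0_negligible R _ x) => //; first by apply: xi => // s [].
      by move=> s [_]; rewrite /= in_itv/= => /lt_eqF ->.
    transitivity (\int[mu]_(s in En) (-1 * x s)).
      apply: eq_Rintegral => s /set_mem[_]; rewrite /= in_itv/= => s0.
      by rewrite ltr0_norm// mulN1r.
    rewrite RintegralZl//; last by apply: xi => // s [].
    by rewrite (int0 m En) ?mulr0// => s [].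
  apply: negligibleS (negligibleU nEp nEn) => s [Ds /=].
  rewrite neq_lt => /orP[s0|s0]; [right|left]; split => //;
    by rewrite /= in_itv/= ?andbT.
(* Nothing is known about x outside ]0, t 1]. As every y n is supported there, q may be replaced by
   its restriction to that interval. *)
pose A : set R := `]0, t 1]%classic.
have mA : measurable A by exact: measurable_itv.
have dqA := dual_restrict HB mA dq.
have qx : q (fun s => \1_A s * x s) = lim ((fun n => q (y n)) @ U).
  rewrite -(px _ dqA); congr (lim (_ @ U)); apply/funext => n; congr q.
  apply/funext => s; rewrite indicE; case: (boolP (s \in A)) => [_|]; first by rewrite mul1r.
  move=> /negP sA; rewrite mul0r ysupp// => st; apply: sA; apply/mem_set.
  by rewrite /A/= in_itv.
have q0 : q (fun s => \1_A s * x s) = 0.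
  have [mAx _] : mem (fun s => \1_A s * x s) /\ nrm (fun s => \1_A s * x s) <= nrm x.
    apply: (mem_le HB) => //.
      by apply: measurable_funM => //; exact: measurable_indic.
    apply: ae_inW => s _; rewrite normrM indicE; case: (_ \in _).
      by rewrite normr1 mul1r.
    by rewrite normr0 mul0r.
  have [_ [_ [K qK]]] := dq.
  apply/eqP; rewrite -normr_le0; apply: le_trans (qK _ mAx) _.
  rewrite ((nrm_eq0 HB mAx).2 _) ?mulr0//.
  apply: negligibleS (negligible_bigcup x0m) => s [Is /=].
  rewrite indicE; case: (boolP (s \in A)) => [/set_mem|_]; last by rewrite mul0r.
  rewrite /A/= in_itv/= => /andP[s0 st] /eqP; rewrite mul1r => xs.
  have [|m ms] := @dyad_cover R h s s0.
    by apply: le_trans st _; have := dyadic_le h0 (leq0n 1); rewrite /dyadic expr0 divr1.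
  (* Block 0 is ]t 1, t 0], which s <= t 1 excludes. *)
  case: m ms => [|m] ms; last by exists m.
  by move: ms; rewrite /dyad/= in_itv/= => /andP[]; rewrite ltNge st.
have qcvg : cvg ((fun n => q (y n)) @ U).
  have [_ [_ [K qK]]] := dq.
  apply: (@ultra_bounded_cvg R U _ (`|K| * B)) => // n.
  apply: le_trans (qK _ (my n)) _.
  apply: (le_trans (ler_wpM2r (nrm_ge0 HB (my n)) (ler_norm K))).
  by rewrite ler_wpM2l.
have : e <= `|lim ((fun n => q (y n)) @ U)|.
  rewrite -(lim_norm qcvg); apply: limr_ge; first exact: is_cvg_norm qcvg.
  exact: Ue.
by rewrite -qx q0 normr0 leNgt e0.
Qed.

(* [t n.+2] is the length of [D n.+1]; the factor [c n] rather than [c n.+1] is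
   what [CX_ge] bounds. *)
Definition dmean n f : R := c n / t n.+2 * \int[mu]_(x in D n.+1) f x.

Lemma dmean_dual_CX n : dual_elt CX nCX (dmean n).
Proof.
apply: dual_eltZ; apply: (@setint_dual_CX n); first exact: measurable_dyad.
exact: dyad_sub_itv.
Qed.

Lemma dmean_le_CX n f : CX f -> `|dmean n f| <= 4 * nCX f.
Proof.
move=> Cf; have c0 := nrm_chi_gt0 n; have t0 := dyadic_gt0 h0 n.
rewrite normrM ger0_norm; last by rewrite divr_ge0 ?ltW// dyadic_gt0.
(* The factor 4 is t n / t n.+2. *)
have -> : 4 * nCX f = c n / t n.+2 * (t n / c n * nCX f).
  rewrite !dyadicS; field; by rewrite !gt_eqF.
apply: ler_wpM2l; first by rewrite divr_ge0// ltW// dyadic_gt0.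
by apply: setint_le => //; [exact: measurable_dyad|exact: dyad_sub_itv].
Qed.

Lemma dmean_dual n : dual_elt mem nrm (dmean n).
Proof. exact/dual_CX_mem/dmean_dual_CX. Qed.

Lemma dmean_le n f : mem f -> `|dmean n f| <= 4 * M * nrm f.
Proof.
move=> mf; have [Cf nf] := mem_CX mf.
by apply: le_trans (dmean_le_CX n Cf) _; rewrite -mulrA ler_wpM2l.
Qed.

(* Otherwise [q := lim dmean n] along an ultrafilter does not vanish at [x], yet
   it takes the same value on all truncations of [x] to ]0, t n.+1], which are
   weakly null. *)
Lemma dmean_cvg0 x : mem x -> (fun n => dmean n x) @ \oo --> 0.
Proof.
move=> mx; apply: contrapT => /ultra_off0[U [e [UU oU e0 Ue]]].
pose q f := lim ((fun n => dmean n f) @ U).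
have dq : dual_elt mem nrm q.
  by apply: (@ultra_dual _ _ _ U _ (4 * M)) => //; [exact: dmean_dual|exact: dmean_le].
pose A n : set R := `]0, t n.+1]%classic.
pose y n s := \1_(A n) s * x s.
have mA n : measurable (A n) by exact: measurable_itv.
have mxI := mem_measurable HB mx.
have my n : mem (y n) /\ nrm (y n) <= nrm x.
  apply: (mem_le HB) => //.
    by apply: measurable_funM => //; exact: measurable_indic.
  apply: ae_inW => s _; rewrite normrM indicE; case: (_ \in _).
    by rewrite normr1 mul1r.
  by rewrite normr0 mul0r.
have y0 : (fun n => q (y n)) @ \oo --> 0.
  apply: (@vanishing_weakly_null y (nrm x)) => //.
  - by move=> n; exact: (my n).1.
  - by move=> n; exact: (my n).2.
  - move=> n s ns; rewrite /y indicE memNset ?mul0r// /A/= in_itv/= => /andP[s0 sn].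
    by apply: ns; rewrite s0/= (le_trans sn)// dyadic_le.
  - move=> m; exists m.+1 => // n /= mn s; rewrite /dyad/= in_itv/= => /andP[ms _].
    rewrite /y indicE memNset ?mul0r// /A/= in_itv/= => /andP[_ sn].
    have tn : t n.+1 <= t m.+2 by exact: dyadic_le.
    by have := lt_le_trans ms (le_trans sn tn); rewrite ltxx.
(* For k >= n the block [D k.+1] lies in ]0, t n.+1], so the truncation leaves [dmean k]
   unchanged. *)
have qE n : q (y n) = q x.
  apply/cvg_lim => //.
  have : cvg ((fun k => dmean k x) @ U).
    by apply: (@ultra_bounded_cvg _ U _ (4 * M * nrm x)) => // k; exact: dmean_le.
  apply: cvg_trans; apply: near_eq_cvg; apply: oU.
  exists n => // k /= nk; rewrite /dmean; congr (_ * _); apply: eq_Rintegral => s /set_mem ks.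
  rewrite /y indicE mem_set ?mul1r// /A/= in_itv/=.
  by have := dyad_sub h0 (leqnn k.+1) ks => /andP[-> sk]/=; rewrite (le_trans sk)// dyadic_le.
have qx0 : q x = 0.
  have : (fun n => q (y n)) @ \oo --> q x by under eq_fun do rewrite qE; exact: cvg_cst.
  by move=> /(cvg_unique _); apply.
have qcvg : cvg ((fun k => dmean k x) @ U).
  by apply: (@ultra_bounded_cvg _ U _ (4 * M * nrm x)) => // k; exact: dmean_le.
have : e <= `|q x|.
  rewrite -(lim_norm qcvg); apply: limr_ge; first exact: is_cvg_norm qcvg.
  exact: Ue.
by rewrite qx0 normr0 leNgt e0.
Qed.

(** Block n.+2 is the one that [averaging] moves to [D n.+1], where [dmean n] reads. Dividing by
    [c n] cancels the factor in [dmean n], and [nrm_chi_le] keeps the norm at most 1. *)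
Definition bump n : R -> R := fun x => (c n)^-1 * chi n.+2 x.

Lemma mem_bump n : mem (bump n).
Proof. by apply: (memZ HB); exact: mem_chi. Qed.

Lemma bump_weakly_null q : dual_elt mem nrm q -> (fun n => q (bump n)) @ \oo --> 0.
Proof.
apply: (@vanishing_weakly_null bump 1) => //.
- exact: mem_bump.
- move=> n; rewrite (nrmZ HB); last exact: mem_chi.
  have c0 := nrm_chi_gt0 n.
  by rewrite gtr0_norm ?invr_gt0// mulrC ler_pdivrMr// mul1r nrm_chi_le.
- move=> n x nx; rewrite /bump indicE memNset ?mulr0// => nx'.
  by apply: nx; exact: dyad_sub nx'.
- move=> m; exists m => // n /= mn x mx; rewrite /bump indicE memNset ?mulr0// => nx.
  by have := dyad_inj h0 mx nx => -[mn']; move: mn; rewrite mn' ltnn.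
Qed.

Lemma Rintegral_dyad n f (r : R) : (forall x, D n x -> f x = r) ->
  \int[mu]_(x in D n) f x = r * t n.+1.
Proof.
move=> fr; transitivity (\int[mu]_(x in D n) r).
  by apply: eq_Rintegral => x /set_mem; exact: fr.
rewrite Rintegral_cst; last exact: measurable_dyad.
by rewrite /= measure_dyad.
Qed.

(** * The averaging operator and the Cesàro space *)

Definition avg f n : R := (t n.+2)^-1 * \int[mu]_(x in D n.+1) f x.
Definition averaging f : R -> R := step h (avg f).

(** Shifting the mean of [D n.+1] outwards to [D n] places it where C|f| is at least mass f n.+1 / t
    n; the ratio t n / t n.+2 gives 4. *)
Lemma averaging_le f : CX f -> mem (averaging f) /\ nrm (averaging f) <= 4 * nCX f.
Proof.
move=> Cf; have [_ _ mCf] := Cf.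
rewrite -[4](@ger0_norm R)// -(nrmZ HB)//.
apply: (mem_le HB); [exact: measurable_step|exact: memZ HB _ _ mCf|].
apply: ae_inW => x _; rewrite /averaging; case: stepP => // [n nx|_]; last by rewrite normr0.
have t0 := dyadic_gt0 h0 n.
rewrite ler_normr; apply/orP; left.
apply: (@le_trans _ _ (4 * (mass f n.+1 / t n))); last first.
  by rewrite ler_wpM2l// cesaro_ge.
have -> : 4 * (mass f n.+1 / t n) = (t n.+2)^-1 * mass f n.+1.
  by rewrite !dyadicS; field; rewrite gt_eqF.
have i0 : 0 <= (t n.+2)^-1 by rewrite invr_ge0 ltW// dyadic_gt0.
rewrite /avg normrM (ger0_norm i0); apply: ler_wpM2l => //.
by apply: setint_mass => //; [exact: measurable_dyad|exact: dyad_sub_itv].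
Qed.

Lemma averagingD f g : CX f -> CX g ->
  averaging (fun x => f x + g x) = (fun x => averaging f x + averaging g x).
Proof.
move=> Cf Cg; apply/funext => x; rewrite /averaging -stepD; congr step.
apply/funext => n; rewrite /avg -mulrDr; congr (_ * _).
have [|H _] := @setint_dual_CX n _ (measurable_dyad h n.+1); last exact: H.
exact: dyad_sub_itv.
Qed.

Lemma averagingZ (a : R) f : CX f ->
  averaging (fun x => a * f x) = (fun x => a * averaging f x).
Proof.
move=> Cf; apply/funext => x; rewrite /averaging -stepZ; congr step.
apply/funext => n; rewrite /avg mulrCA; congr (_ * _).
have [|_ [H _]] := @setint_dual_CX n _ (measurable_dyad h n.+1); last exact: H.
exact: dyad_sub_itv.
Qed.

Lemma mem_dual_bound_ge0 (q : (R -> R) -> R) (K : R) : (forall f, mem f -> `|q f| <= K * nrm f) -> 0 <= K.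
Proof. by move=> qK; exact: (dual_bound_ge0 (mem_chi 0) (nrm_chi_gt0 0) qK). Qed.

Lemma averaging_bound (q : (R -> R) -> R) (K : R) : (forall f, mem f -> `|q f| <= K * nrm f) ->
  forall f, CX f -> `|q (averaging f)| <= K * 4 * nCX f.
Proof.
move=> qK f Cf; have [mA nA] := averaging_le Cf.
apply: le_trans (qK _ mA) _; rewrite -mulrA.
by rewrite ler_wpM2l//; exact: mem_dual_bound_ge0 qK.
Qed.

Lemma averaging_dual q : dual_elt mem nrm q ->
  dual_elt CX nCX (fun f => q (averaging f)).
Proof.
move=> [qD [qZ [K qK]]]; split; [|split].
- move=> f g Cf Cg; rewrite averagingD// qD//; exact: (averaging_le _).1.
- move=> a f Cf; rewrite averagingZ// qZ//; exact: (averaging_le _).1.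
- by exists (K * 4); exact: averaging_bound.
Qed.

Lemma CX_not_dunford_pettis : ~ dunford_pettis CX nCX.
Proof.
have one n : dmean n (averaging (bump n)) = 1.
  have c0 := nrm_chi_gt0 n; have t0 := dyadic_gt0 h0 n.
  rewrite /dmean (@Rintegral_dyad _ _ (avg (bump n) n.+1)); last first.
    by move=> x nx; rewrite /averaging (step_dyad h0 _ nx).
  rewrite /avg (@Rintegral_dyad _ _ (c n)^-1); last first.
    by move=> x nx; rewrite /bump indicE mem_set// mulr1.
  by rewrite !dyadicS; field; rewrite !gt_eqF.
move=> DP.
have : (fun n => dmean n (averaging (bump n))) @ \oo --> 0.
  apply: (DP bump (fun n f => dmean n (averaging f))).
  - by move=> n; exact: (mem_CX (mem_bump n)).1.
  - by move=> q dq; apply: bump_weakly_null; exact: dual_CX_mem.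
  - by move=> n; apply: averaging_dual; exact: dmean_dual.
  - move=> Phi [PD [PZ [L PL]]].
    (* Composing [Phi] with the transpose of [averaging] gives an element of the bidual of X, to
       which reflexivity applies. *)
    have bPsi : bidual_elt mem nrm (fun q => Phi (fun f => q (averaging f))).
      split; [|split].
      + by move=> p q dp dq; apply: PD; exact: averaging_dual.
      + by move=> a p dp; apply: PZ; exact: averaging_dual.
      + exists (L * 4) => p K dp pK; rewrite -mulrA [4 * K]mulrC.
        by apply: PL; [exact: averaging_dual|exact: averaging_bound].
    have [x [mx Psix]] := refX bPsi.
    under eq_fun do rewrite (Psix _ (dmean_dual _)).
    exact: dmean_cvg0.
under eq_fun do rewrite one.
move=> /(cvg_unique _) one0; suff : (0 : R) == 1 by rewrite eq_sym oner_eq0.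
apply/eqP; exact: one0 (@norm_hausdorff _ R) _ (cvg_cst (1 : R)).
Qed.

(** * Lifting functionals on X to the Tandori space *)

(** Only finitely many blocks carry a value, so linearity alone evaluates phi. *)
Lemma dual_step (phi : (R -> R) -> R) (a : nat -> R) N : dual_elt mem nrm phi ->
  let w := step h (fun n => if (n < N)%N then a n else 0) in
  mem w /\ phi w = \sum_(n < N) a n * phi (chi n).
Proof.
move=> [pD [pZ _]]; elim: N => [|N [mN IH]] /=.
  have -> : step h (fun n => if (n < 0)%N then a n else 0) = (fun x => 0 * chi 0 x).
    by apply/funext => x; rewrite mul0r; case: (stepP h0).
  split; first by apply: (memZ HB); exact: mem_chi.
  by rewrite pZ ?mul0r ?big_ord0//; exact: mem_chi.
have -> : step h (fun n => if (n < N.+1)%N then a n else 0) =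
    (fun x => step h (fun n => if (n < N)%N then a n else 0) x + a N * chi N x).
  apply/funext => x; case: (stepP h0) => [n nx|nx].
    rewrite (step_dyad h0 _ nx) ltnS indicE.
    case: (ltngtP n N) => nN.
    - rewrite memNset ?mulr0 ?addr0// => /(dyad_inj h0 nx) nN'.
      by move: nN; rewrite nN' ltnn.
    - rewrite memNset ?mulr0 ?addr0// => /(dyad_inj h0 nx) nN'.
      by move: nN; rewrite nN' ltnn.
    - by rewrite -nN mem_set// mulr1 add0r.
  rewrite step_out// indicE memNset ?mulr0 ?addr0// => Nx; apply: nx.
  by have := dyad_sub h0 (leq0n N) Nx; rewrite /dyadic expr0 divr1.
have mNc : mem (fun x => a N * chi N x) by apply: (memZ HB); exact: mem_chi.
split; first exact: (memD HB).
by rewrite pD// pZ ?IH ?big_ord_recr//; exact: mem_chi.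
Qed.

(** The index shift makes the weight 1 / t n.+1 of [chi n] multiply [mass f n.+1], the mass that
    C|f| controls on [D n]. *)
Definition lift_coef (phi : (R -> R) -> R) n : R :=
  if n is k.+1 then phi (chi k) / t k.+1 else 0.
Definition lifting phi : R -> R := step h (lift_coef phi).

(* The sum is the value of [phi] on a step function dominated by [2 C|f|]. *)
Lemma lift_coef_sum phi (K : R) f N : dual_elt mem nrm phi ->
  (forall g, mem g -> `|phi g| <= K * nrm g) -> CX f ->
  \sum_(n < N) `|lift_coef phi n| * mass f n <= 2 * K * nCX f.
Proof.
move=> dp pK Cf; have K0 := mem_dual_bound_ge0 pK; have [_ _ mCf] := Cf.
case: N => [|N].
  by rewrite big_ord0 !mulr_ge0// (nrm_ge0 HB).
rewrite big_ord_recl/= normr0 mul0r add0r.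
(* The signs turn each term of phi w into an absolute value. *)
pose a n := Num.sg (phi (chi n)) * (mass f n.+1 / t n.+1).
have [mw pw] := dual_step a N dp; set w := step _ _ in mw pw.
have -> : \sum_(i < N) `|phi (chi i) / t i.+1| * mass f i.+1 = phi w.
  rewrite pw; apply: eq_bigr => i _.
  have t0 := dyadic_gt0 h0 i.+1.
  rewrite /a normrM [`|phi _|]normrEsg (gtr0_norm (x := (t i.+1)^-1)) ?invr_gt0//.
  by ring.
apply: le_trans (ler_norm _) _; apply: le_trans (pK _ mw) _.
have -> : 2 * K * nCX f = K * (2 * nCX f) by ring.
apply: ler_wpM2l => //; rewrite -[2](@ger0_norm R)// -(nrmZ HB)//.
apply: (mem_le HB _ (memZ HB _ mCf) _).2; first exact: measurable_step.
apply: ae_inW => x _; rewrite /w; case: (stepP h0) => [n nx|_]; last by rewrite normr0.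
case: ifPn => _; last by rewrite normr0.
have t0 := dyadic_gt0 h0 n; have tS0 := dyadic_gt0 h0 n.+1.
rewrite ler_normr; apply/orP; left.
apply: (@le_trans _ _ (2 * (mass f n.+1 / t n))); last first.
  by rewrite ler_wpM2l// cesaro_ge.
have -> : 2 * (mass f n.+1 / t n) = mass f n.+1 / t n.+1.
  by rewrite !dyadicS; field; rewrite gt_eqF.
have m0 : 0 <= mass f n.+1 / t n.+1 by rewrite divr_ge0 ?mass_ge0// ltW.
rewrite /a normrM (ger0_norm m0) normr_sg.
by case: (_ != 0); rewrite ?mul1r ?mul0r.
Qed.

(** Only the finitely many blocks with index below N reach beyond x, so the sum of their absolute
    values is an admissible bound. *)
Lemma tildeE_step_fin (a : nat -> R) x : 0 < x -> (tildeE I (step h a) x < +oo)%E.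
Proof.
move=> x0; have [N Nx] := dyadic_lt h x0.
apply: (@le_lt_trans _ _ (\sum_(n < N) `|a n|)%:E); last exact: ltry.
apply: ge_ereal_inf; exists (\sum_(n < N) `|a n|)%:E => //=.
apply: (@negligibleS _ _ _ mu set0); last exact: negligible_set0.
move=> s [[_ /=]]; rewrite in_itv/= andbT => xs; rewrite lte_fin ltNge => /negP; apply.
case: (stepP h0) => [n ns|_]; last by rewrite normr0 sumr_ge0.
have nN : (n < N)%N.
  rewrite ltnNge; apply/negP => /(dyadic_le h0) nN.
  have /andP[_ sn] := dyad_sub h0 (leqnn n) ns.
  by have := lt_le_trans (lt_le_trans Nx xs) (le_trans sn nN); rewrite ltxx.
by rewrite (bigD1 (Ordinal nN))//= lerDl sumr_ge0.
Qed.

(** The supremum over the blocks reaching x, those with x <= t n, is bounded by the sum over them; a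
    series can be integrated term by term. *)
Lemma tildeE_step_le (a : nat -> R) x : 0 < x ->
  (tildeE I (step h a) x <= \sum_(n <oo) (`|a n| * \1_`]0, t n] x)%:E)%E.
Proof.
move=> x0; set T := (X in (_ <= X)%E).
have term0 n : (0 <= (`|a n| * \1_`]0, t n] x)%:E)%E by rewrite lee_fin mulr_ge0// indicE.
apply: ge_ereal_inf; exists T => //=.
apply: (@negligibleS _ _ _ mu set0); last exact: negligible_set0.
move=> s [[_ /=]]; rewrite in_itv/= andbT => xs; rewrite ltNge => /negP; apply.
case: (stepP h0) => [n ns|_]; last by rewrite normr0; exact: nneseries_ge0.
have /andP[_ sn] := dyad_sub h0 (leqnn n) ns.
have -> : `|a n|%:E = (`|a n| * \1_`]0, t n] x)%:E.
  by rewrite indicE mem_set ?mulr1//= in_itv/= x0 (le_trans xs).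
apply: le_trans (@nneseries_lim_ge _ _ xpredT 0%N n.+1 _); last by move=> *; exact: term0.
by rewrite big_nat_recr//= leeDr// sume_ge0.
Qed.

Local Notation kmem := (kothe_mem I mem nrm).
Local Notation knrm := (kothe_nrm I mem nrm).
Local Notation TX := (tilde_mem I kmem).
Local Notation nTX := (tilde_nrm I knrm).

(** For f in the unit ball of X, integrating |f| against the series of [tildeE_step_le] gives at
    most the sum of the |lift_coef phi n| * mass f n. By [lift_coef_sum] this is at most 2 K times
    the [CX] norm of f, hence at most 2 K M. *)
Lemma lifting_le phi (K : R) : dual_elt mem nrm phi ->
  (forall g, mem g -> `|phi g| <= K * nrm g) ->
  TX (lifting phi) /\ nTX (lifting phi) <= 2 * K * M.
Proof.
move=> dp pK; have K0 := mem_dual_bound_ge0 pK.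
(* Infinitely many blocks accumulate at 0, so the bounds on the majorant are taken at x > 0. *)
have ae0 : ae_in I (fun x => 0 < x).
  apply: ae_inS (ae_in_neq I 0) => x Ix x0; rewrite lt_def x0/=.
  by case: HI => _ _ /(_ _ Ix) /=; rewrite in_itv/= andbT.
have [|kt nt] := @kothe_nrm_le _ _ _ _ HB (fun x => fine (tildeE I (lifting phi) x)) (2 * K * M) (measurable_tilde HI _).
  move=> f mf nf; have [Cf nCf] := mem_CX mf.
  have M0 : 0 <= M := cesaro_bound_ge0.
  pose b := lift_coef phi.
  pose F n x := ((`|f x| * (`|b n| * \1_`]0, t n] x))%:E : \bar R).
  have mfI := mem_measurable HB mf.
  have F0 n x : (0 <= F n x)%E by rewrite lee_fin !mulr_ge0// indicE.
  have mF n : measurable_fun I (F n).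
    apply/measurable_EFinP; apply: measurable_funM; first exact: measurableT_comp.
    by apply: measurable_funM => //; exact: measurable_indic.
  have mS : measurable_fun I (fun x => \sum_(n <oo) F n x)%E.
    by apply: ge0_emeasurable_sum => // n x Ix _; exact: F0.
  apply: (@le_trans _ _ (\int[mu]_(x in I) (\sum_(n <oo) F n x))%E).
    apply: ae_ge0_le_integral => //.
    - apply/measurable_EFinP; apply: measurableT_comp => //.
      by apply: measurable_funM => //; exact: measurable_tilde.
    - by move=> x Ix; exact: nneseries_ge0.
    - apply: ae_in_ae; apply: ae_inS (ae_inI ae0 (ae_in_neq I 1)) => x Ix [x0 x1].
      have t0 := tildeE_ge0 HI (lifting phi) Ix x1.
      have tfin : tildeE I (lifting phi) x \is a fin_num.
        by rewrite ge0_fin_numE//; exact: tildeE_step_fin.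
      rewrite normrM EFinM (ger0_norm (fine_ge0 t0)) fineK//.
      under eq_eseriesr do rewrite /F EFinM.
      rewrite nneseriesZl; last by move=> n _; rewrite lee_fin mulr_ge0// indicE.
      by apply: lee_wpmul2l; [rewrite lee_fin|exact: tildeE_step_le].
  rewrite integral_nneseries//.
  have iF n : (\int[mu]_(x in I) F n x <= (`|b n| * mass f n)%:E)%E.
    pose A : set R := `]0, t n]%classic.
    have mA : measurable A by exact: measurable_itv.
    have fi := CX_integrable Cf (dyadic_lt1 n).
    have massE : (mass f n)%:E = (\int[mu]_(x in `[0%R, t n]) `|f x|%:E)%E.
      rewrite /mass /Rintegral fineK//.
      by apply: integrable_fin_num => //; exact: integrable_norm fi.
    have -> : (\int[mu]_(x in I) F n x =
        `|b n|%:E * \int[mu]_(x in I `&` A) `|f x|%:E)%E.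
      rewrite integral_mkcondr -ge0_integralZl_EFin//.
      - apply: eq_integral => x _; rewrite /F patchE indicE -/A.
        by case: (x \in A); rewrite ?mulr1 ?mulr0 ?mule0// EFinM muleC.
      - by move=> x _; rewrite patchE; case: ifP.
      - apply: (measurable_restrict _ mA mI).1.
        apply: measurable_funS mI _ _; first exact: subIsetl.
        by apply/measurable_EFinP; exact: measurableT_comp.
    rewrite EFinM massE lee_wpmul2l ?lee_fin//; apply: ge0_subset_integral => //.
    - exact: measurableI.
    - by have /integrableP[] := integrable_norm fi.
    - move=> x [_]; rewrite /A /= !in_itv/= => /andP[x0 ->]; by rewrite ltW.
  (* [lift_coef_sum] bounds all partial sums uniformly in N, hence the series. *)
  apply: lime_le; first by apply: is_cvg_nneseries => n _ _; exact: integral_ge0.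
  apply: nearW => N; rewrite big_mkord.
  apply: (@le_trans _ _ (\sum_(n < N) (`|b n| * mass f n)%:E)%E); first exact: lee_sum.
  rewrite sumEFin lee_fin; apply: le_trans (lift_coef_sum N dp pK Cf) _.
  apply: ler_wpM2l; first by rewrite mulr_ge0.
  by apply: le_trans nCf _; rewrite -[leRHS]mulr1 ler_wpM2l.
split => //; split => //; first exact: measurable_step.
by apply: ae_inS ae0 => x _; exact: tildeE_step_fin.
Qed.

Lemma liftingD (p q : (R -> R) -> R) :
  lifting (fun f => p f + q f) = (fun x => lifting p x + lifting q x).
Proof.
apply/funext => x; rewrite /lifting -stepD; congr step.
by apply/funext => -[|n]; rewrite /= ?addr0// mulrDl.
Qed.

Lemma liftingZ (a : R) (p : (R -> R) -> R) :
  lifting (fun f => a * p f) = (fun x => a * lifting p x).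
Proof.
apply/funext => x; rewrite /lifting -stepZ; congr step.
by apply/funext => -[|n]; rewrite /= ?mulr0// mulrA.
Qed.

Lemma lifting_mem p : dual_elt mem nrm p -> TX (lifting p).
Proof. by move=> dp; have [_ [_ [K pK]]] := dp; exact: (lifting_le dp pK).1. Qed.

(** The value c n of [dmean n] at [chi n.+1] cancels the normalisation of [bump n], leaving the
    length t n.+3 of [D n.+2] divided by t n.+2. *)
Lemma pairing_lifting n : pairing I (bump n) (lifting (dmean n)) = 2^-1.
Proof.
have c0 := nrm_chi_gt0 n; have t0 := dyadic_gt0 h0 n.
have dmE : dmean n (chi n.+1) = c n.
  rewrite /dmean (@Rintegral_dyad _ _ 1); last by move=> x nx; rewrite indicE mem_set.
  by rewrite mul1r; field; rewrite gt_eqF// dyadic_gt0.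
have -> : pairing I (bump n) (lifting (dmean n)) =
    \int[mu]_(x in D n.+2) (t n.+2)^-1.
  rewrite -(setIidr (@dyad_subI n.+2)) Rintegral_mkcondr.
  apply: eq_Rintegral => x _; rewrite patchE /bump indicE.
  case: (boolP (x \in D n.+2)) => [/set_mem nx|_]; last by rewrite mulr0 mul0r.
  rewrite /lifting (step_dyad h0 _ nx) /= dmE mulr1.
  by field; rewrite !gt_eqF ?dyadic_gt0.
rewrite (@Rintegral_dyad _ _ (t n.+2)^-1)// [t n.+3]dyadicS.
by field; rewrite gt_eqF// dyadic_gt0.
Qed.

Lemma tilde_not_dunford_pettis : ~ dunford_pettis TX nTX.
Proof.
move=> DP.
have : (fun n => pairing I (bump n) (lifting (dmean n))) @ \oo --> 0.
  apply: (DP (fun n => lifting (dmean n)) (fun n => pairing I (bump n))).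
  - by move=> n; exact/lifting_mem/dmean_dual.
  - move=> Q [QD [QZ [L QL]]].
    (* Composing Q with [lifting] gives an element of the bidual of X, so [dmean_cvg0] yields weak
       nullity of the lifted functionals. *)
    have bPsi : bidual_elt mem nrm (fun p => Q (lifting p)).
      split; [|split].
      + by move=> p q dp dq; rewrite liftingD QD//; exact: lifting_mem.
      + by move=> a p dp; rewrite liftingZ QZ//; exact: lifting_mem.
      + exists (`|L| * (2 * M)) => p K dp pK; have [Tp np] := lifting_le dp pK.
        apply: le_trans (QL _ Tp) _.
        apply: (le_trans (ler_wpM2r (kothe_nrm_ge0 HB _) (ler_norm L))).
        rewrite -mulrA; apply: ler_wpM2l => //.
        by apply: le_trans np _; rewrite mulrAC.
    have [x [mx Psix]] := refX bPsi.
    under eq_fun do rewrite (Psix _ (dmean_dual _)).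
    exact: dmean_cvg0.
  - by move=> n; exact/(pairing_dual HI HB)/mem_bump.
  - move=> Phi bPhi; apply: (bump_weakly_null (q := fun f => Phi (pairing I f))).
    exact: pairing_adjoint HI HB _ bPhi.
under eq_fun do rewrite pairing_lifting.
move=> /(cvg_unique _) half0; suff : (0 : R) == 2^-1 by rewrite eq_sym invr_eq0 pnatr_eq0.
apply/eqP; exact: half0 (@norm_hausdorff _ R) _ (cvg_cst (2^-1 : R)).
Qed.

End Cesaro.

Lemma not_dunford_pettis (R : realType) (I : set R) mem nrm :
  base_interval I -> symmetric_space I mem nrm -> reflexive_space mem nrm ->
  cesaro_bounded I mem nrm ->
  ~ dunford_pettis (CX_mem I mem) (CX_nrm nrm) /\
  ~ dunford_pettis (tilde_mem I (kothe_mem I mem nrm))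
                   (tilde_nrm I (kothe_nrm I mem nrm)).
Proof.
move=> HI HS refX [M HM].
have [h [h0 h1 memh]] := symmetric_small_interval HI HS.
split; [exact: (CX_not_dunford_pettis HI HS h0 h1 memh HM refX)|].
exact: (tilde_not_dunford_pettis HI HS h0 h1 memh HM refX).
Qed.

Theorem theorem12 (R : realType) :
  (* (i) I = [0, oo) *)
  (forall (mem : (R -> R) -> Prop) (nrm : (R -> R) -> R),
     let I : set R := `[0%R, +oo[%classic in
     symmetric_space I mem nrm -> reflexive_space mem nrm -> cesaro_bounded I mem nrm ->
     ~ dunford_pettis (CX_mem I mem) (CX_nrm nrm) /\
     ~ dunford_pettis (tilde_mem I (kothe_mem I mem nrm))
                      (tilde_nrm I (kothe_nrm I mem nrm))) /\
  (* (ii) I = [0, 1] *)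
  (forall (mem : (R -> R) -> Prop) (nrm : (R -> R) -> R),
     let I : set R := `[0%R, 1%R]%classic in
     symmetric_space I mem nrm -> reflexive_space mem nrm -> cesaro_bounded I mem nrm ->
     fatou_property I mem nrm -> copson_bounded I mem nrm ->
     ~ dunford_pettis (CX_mem I mem) (CX_nrm nrm) /\
     ~ dunford_pettis (tilde_mem I (kothe_mem I mem nrm))
                      (tilde_nrm I (kothe_nrm I mem nrm))).
Proof.
split=> mem nrm I symX refX cesX; last move=> _ _.
  exact: not_dunford_pettis (@base_interval_ray R) symX refX cesX.
exact: not_dunford_pettis (@base_interval_unit R) symX refX cesX.
Qed.
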